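(* Let $S$ be a qubit with Hamiltonian $H_S=\frac{\Delta}{2}\sigma^z$, $\Delta>0$, and let $\rho^+=\frac12(\mathbb 1+\sigma^x)$. For every qubit state $\rho$ of $S$ with $[\rho,H_S]\neq0$ and every $\epsilon>0$, there exists a state $\rho'$ of $S$ with $\|\rho'-\rho^+\|_1\le\epsilon$ such that $\rho$ can be transformed to $\rho'$ by a correlating-catalytic translationally invariant operation (CCTIO), i.e. with a correlating catalyst of sufficiently large but finite dimension.
   Context: $\sigma^x,\sigma^y,\sigma^z$ are the Pauli matrices and $\|\cdot\|_1$ is the trace norm. For a quantum system with Hamiltonian $H$ (a self-adjoint operator), a translationally invariant operation (TIO) is a completely positive trace-preserving linear map $\mathcal E$ with $\mathcal E(e^{-iHt}\rho e^{iHt})=e^{-iHt}\mathcal E(\rho)e^{iHt}$ for all states $\rho$ and all $t\in\mathbb R$. A state $\rho$ of $S$ can be transformed to a state $\rho'$ of $S$ by CCTIO if there exist a finite-dimensional auxiliary system $C$ (the correlating catalyst) with some Hamiltonian $H_C$, a state $\sigma$ of $C$, and a TIO $\mathcal E$ on $SC$ with respect to the total Hamiltonian $H_S\otimes\mathbb 1+\mathbb 1\otimes H_C$ such that $\mathrm{Tr}_C[\mathcal E(\rho\otimes\sigma)]=\rho'$ and $\mathrm{Tr}_S[\mathcal E(\rho\otimes\sigma)]=\sigma$ (the output may be correlated between $S$ and $C$). *)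

(* Defs.v *)
From HB Require Import structures.
From mathcomp Require Import all_boot all_order all_algebra spectral.
From mathcomp Require Import complex mxtens.
From mathcomp Require Import all_classical all_reals all_analysis.

Set Implicit Arguments.
Unset Strict Implicit.
Unset Printing Implicit Defensive.

Import Order.TTheory GRing.Theory Num.Theory.
Import numFieldTopology.Exports numFieldNormedType.Exports.
Local Open Scope ring_scope.
Local Open Scope sesquilinear_scope.

Section MatrixFunctions.
Variable C : numClosedFieldType.

(* The limit is taken in the (entrywise) matrix topology over C. *)
Definition expmx n (A : 'M[C]_n) : 'M[C]_n :=
  limn (series (fun k => k`!%:R^-1 *: A ^+ k)).

(* Functional calculus: [A = invmx P *m diag_mx d *m P] for normal [A], with
   [P = spectralmx A] unitary and [d = spectral_diag A] the eigenvalues.  It is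
   only meaningful for positive semidefinite [A]. *)
Definition sqrtmx n (A : 'M[C]_n) : 'M[C]_n :=
  invmx (spectralmx A) *m diag_mx (map_mx sqrtC (spectral_diag A))
    *m spectralmx A.

Definition trace_norm n (A : 'M[C]_n) : C := \tr (sqrtmx (A ^t* *m A)).

(* [0 <= z] in C means that z is a nonnegative real, so this entails that [A]
   is self-adjoint. *)
Definition psdmx n (A : 'M[C]_n) : Prop :=
  forall v : 'cV[C]_n, 0 <= (v ^t* *m A *m v) 0 0.

Definition is_state n (rho : 'M[C]_n) : Prop := psdmx rho /\ \tr rho = 1.

End MatrixFunctions.

Section Channels.
Variable C : numClosedFieldType.

(* On a composite system, indices follow the convention of [tensmx]: the pair
   (a, b) of basis labels has index [mxtens_index (a, b)]. *)

(* The map E (x) id_k; see [ampliation_tens]. *)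
Definition ampliation m n k (E : 'M[C]_m -> 'M[C]_n)
    (X : 'M[C]_(m * k)) : 'M[C]_(n * k) :=
  \matrix_(i, j)
    E (\matrix_(a, b) X (mxtens_index (a, (mxtens_unindex i).2))
                        (mxtens_index (b, (mxtens_unindex j).2)))
      (mxtens_unindex i).1 (mxtens_unindex j).1.

Lemma ampliation_tens m n k (E : {linear 'M[C]_m -> 'M[C]_n})
    (A : 'M[C]_m) (B : 'M[C]_k) :
  ampliation E (A *t B) = E A *t B.
Proof.
apply/matrixP => i j; rewrite !mxE.
set b := B _ _; rewrite -[LHS]/(E _ _ _).
have -> : \matrix_(a, c) (A *t B) (mxtens_index (a, (mxtens_unindex i).2))
    (mxtens_index (c, (mxtens_unindex j).2)) = b *: A.
  by apply/matrixP => a c; rewrite !mxE !mxtens_indexK /= mulrC.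
by rewrite linearZ mxE mulrC.
Qed.

Definition completely_positive m n (E : 'M[C]_m -> 'M[C]_n) : Prop :=
  forall k (X : 'M[C]_(m * k)), psdmx X -> psdmx (ampliation E X).

Definition trace_preserving m n (E : 'M[C]_m -> 'M[C]_n) : Prop :=
  forall X, \tr (E X) = \tr X.

(* Tr_2, tracing out the second factor. *)
Definition ptrace2 m n (X : 'M[C]_(m * n)) : 'M[C]_m :=
  \matrix_(a, b) \sum_(c < n) X (mxtens_index (a, c)) (mxtens_index (b, c)).

(* Tr_1, tracing out the first factor. *)
Definition ptrace1 m n (X : 'M[C]_(m * n)) : 'M[C]_n :=
  \matrix_(a, b) \sum_(c < m) X (mxtens_index (c, a)) (mxtens_index (c, b)).

Lemma ptrace2_tens m n (A : 'M[C]_m) (B : 'M[C]_n) :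
  ptrace2 (A *t B) = \tr B *: A.
Proof.
apply/matrixP => a b; rewrite !mxE mulr_suml; apply: eq_bigr => c _.
by rewrite !mxE !mxtens_indexK /= mulrC.
Qed.

Lemma ptrace1_tens m n (A : 'M[C]_m) (B : 'M[C]_n) :
  ptrace1 (A *t B) = \tr A *: B.
Proof.
apply/matrixP => a b; rewrite !mxE mulr_suml; apply: eq_bigr => c _.
by rewrite !mxE !mxtens_indexK.
Qed.

Definition pauli_x : 'M[C]_2 := \matrix_(i, j) (i != j)%:R.
Definition pauli_z : 'M[C]_2 := \matrix_(i, j) ((-1) ^+ i *+ (i == j)).

(* The state (1 + sigma^x) / 2. *)
Definition rho_plus : 'M[C]_2 := 2^-1 *: (1%:M + pauli_x).

End Channels.

Section TranslationInvariance.
Variable R : realType.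
Local Open Scope complex_scope.
Local Notation C := R[i].

(* e^{-iHt} rho e^{iHt} *)
Definition evolve n (H : 'M[C]_n) (t : R) (rho : 'M[C]_n) : 'M[C]_n :=
  expmx (- ('i * t%:C) *: H) *m rho *m expmx (('i * t%:C) *: H).

Definition is_TIO n (H : 'M[C]_n) (E : {linear 'M[C]_n -> 'M[C]_n}) : Prop :=
  [/\ completely_positive E, trace_preserving E
    & forall rho, is_state rho ->
      forall t : R, E (evolve H t rho) = evolve H t (E rho)].

Definition total_ham m n (HS : 'M[C]_m) (HC : 'M[C]_n) : 'M[C]_(m * n) :=
  HS *t 1%:M + 1%:M *t HC.

Definition CCTIO_transformable n (HS rho rho' : 'M[C]_n) : Prop :=
  exists (d : nat) (HC sigma : 'M[C]_d)
         (E : {linear 'M[C]_(n * d) -> 'M[C]_(n * d)}),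
    [/\ HC \is hermsymmx, is_state sigma, is_TIO (total_ham HS HC) E,
        ptrace2 (E (rho *t sigma)) = rho'
      & ptrace1 (E (rho *t sigma)) = sigma].

Definition qubit_ham (Delta : R) : 'M[C]_2 := (Delta / 2)%:C *: pauli_z C.

End TranslationInvariance.

(* Main.v *)
(* The catalyst carries a quantum phase reference, namely an energy ladder with
   raising shift T, together with a classical record b = (j_1, ..., j_k) of
   outcomes in Z/4.  In each step the incoming qubit rho is absorbed into the
   ladder by a covariant measurement of its phase relative to the ladder; the
   outcome j is appended to b, and a fresh qubit is emitted by a covariant map
   that turns <w(b) T> into its off-diagonal entry.  Both operations are
   functions of T and so leave the phase of the ladder undisturbed.  With
   zeta_j = i^j, the sum s of the zeta_j in b satisfies
     E[conj s T] = k rho_01  and  E|s|^2 = k + |rho_01|^2 (k^2 - k),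
   hence E|s - k rho_10 T|^2 <= k, and emitting a qubit in the state
   proportional to k rho_10 |0> + s |1> gives an output whose infidelity with
   rho_plus is at most 1 / (2 k |rho_01|^2).  After N steps the catalyst is
   reset to its incoherent starting state, so the uniform mixture of the
   catalyst states at times 0, ..., N is exactly invariant, and the output is
   the average over these times of the emitted qubits, which tends to rho_plus
   as N grows. *)
From HB Require Import structures.
Require Import Defs.
From mathcomp Require Import all_boot all_order all_algebra complex.
From mathcomp Require Import all_classical all_reals all_analysis.
From mathcomp Require Import spectral mxtens ring lra zify.

Set Implicit Arguments.
Unset Strict Implicit.
Unset Printing Implicit Defensive.

Import Order.TTheory GRing.Theory Num.Theory.
Import numFieldTopology.Exports numFieldNormedType.Exports.
Local Open Scope ring_scope.
Local Open Scope sesquilinear_scope.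

(** * Evolution under a diagonal Hamiltonian *)

Section MatrixTopology.
Local Open Scope classical_set_scope.
Variables (T : topologicalType) (m n : nat).

(** This makes the limit in [expmx] unique. A neighbourhood of one entry extends to a neighbourhood
    of the matrix by leaving the other entries free, so separation is inherited entrywise. *)
Lemma mx_hausdorff : hausdorff_space T -> hausdorff_space 'M[T]_(m, n).
Proof.
move=> hT M N MN; apply/matrixP => i j; apply: hT => P Q PM QN.
have nb (X : 'M[T]_(m, n)) (S : set T) : nbhs (X i j) S ->
    nbhs X [set Y : 'M[T]_(m, n) | S (Y i j)].
  move=> h; exists (fun a b => if (a == i) && (b == j) then S else setT).
    by move=> a b; case: ifP => [/andP[/eqP-> /eqP->] //|_]; exact: filterT.
  by move=> Y /(_ i j); rewrite !eqxx.
by have [Y [PY QY]] := MN _ _ (nb _ _ PM) (nb _ _ QN); exists (Y i j).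
Qed.

Lemma cvg_mx_entry (u : nat -> 'M[T]_(m, n)) (l : 'M[T]_(m, n)) :
  (forall i j, (fun k => u k i j) @ \oo --> l i j) -> u @ \oo --> l.
Proof.
move=> ul S [P Pl PS].
have : \forall k \near \oo, forall i j, P i j (u k i j).
  by apply: filter_forall => i; apply: filter_forall => j;
    exact: (ul i j _ (Pl i j)).
by apply: filterS => k; exact: PS.
Qed.

End MatrixTopology.

Section UnitaryEvolution.
Local Open Scope complex_scope.
Local Open Scope classical_set_scope.
Variable R : realType.
Local Notation C := R[i].

Definition cis (x : R) : C := cos x +i* sin x.

Lemma cisD x y : cis (x + y) = cis x * cis y.
Proof.
by apply/eqP; rewrite eq_complex /= cosD sinD [sin x * _ + _]addrC !eqxx.
Qed.

Lemma cis0 : cis 0 = 1.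
Proof. by rewrite /cis cos0 sin0. Qed.

Lemma exp_term_cis (x : R) k :
  k`!%:R^-1 * ('i * x%:C) ^+ k = cos_coeff x k +i* sin_coeff x k :> C.
Proof.
(* Powers of ['i] are split by parity. The exponent [k.-1./2] is the one in [sin_coeff] and equals
   [k./2] for odd [k]. *)
have hi : ('i : C) ^+ k =
    ((~~ odd k)%:R * (-1) ^+ k./2) +i* ((odd k)%:R * (-1) ^+ k.-1./2).
  have h2 m : ('i : C) ^+ m.*2 = ((-1) ^+ m)%:C.
    by rewrite -muln2 mulnC exprM sqr_i rmorphXn /= rmorphN1.
  rewrite -{1}(odd_double_half k); case: (boolP (odd k)) => ko /=.
    rewrite add1n exprS h2.
    have -> : (k.-1)./2 = k./2 by case: k ko => //= k;
      rewrite uphalf_half => /negbTE->.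
    by apply/eqP; rewrite eq_complex /= !mul0r !mul1r ?subr0 ?mulr0 ?add0r
      ?addr0 ?subrr !eqxx.
  by rewrite add0n h2; apply/eqP; rewrite eq_complex /= mul1r mul0r !eqxx.
rewrite exprMn hi -[x%:C ^+ k]rmorphXn -(rmorph_nat (real_complex R)) -fmorphV /=.
rewrite /cos_coeff /sin_coeff /=; apply/eqP; rewrite eq_complex /=.
by rewrite !mul0r !mulr0 !subr0 !addr0; apply/andP; split; apply/eqP;
  rewrite ?add0r; 
   rewrite mulrC.
Qed.

Lemma norm_subc_le (a b c d : R) :
  `|(a +i* b) - (c +i* d) : C| <= (`|a - c| + `|b - d|)%:C.
Proof.
have -> : (a +i* b : C) - (c +i* d) = (a - c)%:C + 'i * (b - d)%:C.
  by apply/eqP; rewrite eq_complex /= !mul0r !mul1r subr0 addr0 !add0r !eqxx.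
rewrite (le_trans (ler_normD _ _)) // normrM.
have nC (z : R) : `|z%:C| = `|z|%:C :> C.
  by rewrite normc_def /= expr0n addr0 sqrtr_sqr.
by rewrite !nC normc_def /= expr0n expr1n add0r sqrtr1 mul1r rmorphD.
Qed.

Lemma cvg_complex (u v : nat -> R) (a b : R) :
  u n @[n --> \oo] --> a -> v n @[n --> \oo] --> b ->
  (fun n => (u n +i* v n : C^o)) @ \oo --> (a +i* b : C^o).
Proof.
move=> /cvgrPdist_lt ua /cvgrPdist_lt vb; apply/cvgrPdist_lt => /= e e0.
have ereal : (@complex.Re R e)%:C = e by apply: RRe_real; rewrite realE ltW.
have e0' : 0 < @complex.Re R e / 2 by rewrite divr_gt0 // -ltcR ereal.
near=> n.
apply: le_lt_trans (norm_subc_le _ _ _ _) _.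
rewrite -ereal ltcR [complex.Re e]splitr ltrD //.
- by near: n; apply: ua.
- by near: n; apply: vb.
Unshelve. all: by end_near. Qed.

(** The partial sums of the exponential series stay diagonal, and the real and imaginary parts of
    their entries are partial sums of the cosine and sine series. *)
Lemma expmx_diag n (x : 'I_n -> R) :
  expmx (diag_mx (\row_j ('i%C * (x j)%:C))) = diag_mx (\row_j cis (x j)) :>
    'M[C]_n.
Proof.
rewrite /expmx; set A := diag_mx _.
have AX k : A ^+ k = diag_mx (\row_j (('i%C * (x j)%:C) ^+ k)).
  elim: k => [|k IH].
    by apply/matrixP => i j; rewrite !mxE expr0.
  by rewrite exprS IH /A -[_ * _]/(_ *m _) mulmx_diag; congr diag_mx;
     apply/rowP => j; rewrite !mxE exprS.
have serE N i j : series (fun k => k`!%:R^-1 *: A ^+ k) N i j =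
    ((series (cos_coeff (x j)) N) +i* (series (sin_coeff (x j)) N)) *+ (i == j).
  rewrite /series /= summxE.
  transitivity (\sum_(0 <= k < N) (k`!%:R^-1 * ('i%C * (x j)%:C) ^+ k) *+ (i ==
    j)).
    by apply: eq_bigr => k _; rewrite mxE AX !mxE mulrnAr; case: eqP => [->|].
  rewrite sumrMnl; case: eqP => _; last by rewrite !mulr0n.
  rewrite !mulr1n (eq_bigr _ (fun k _ => exp_term_cis (x j) k)).
  elim/big_rec3: _ => // k a b c _ ->.
  by apply/eqP; rewrite eq_complex /= !eqxx.
apply: (@cvg_lim _ (mx_hausdorff (@norm_hausdorff _ C^o))) => //.
apply: (@cvg_mx_entry C^o) => i j; rewrite !mxE.
rewrite (_ : (fun k => _) = fun N => ((series (cos_coeff (x j)) N) +i* (series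
  (sin_coeff (x j)) N)) *+ (i == j)); last by apply/funext => N; rewrite serE.
case: eqP => [->|_]; last by rewrite mulr0n; exact: cvg_cst.
rewrite mulr1n; apply: cvg_complex.
- rewrite cos.unlock; exact: is_cvg_series_cos_coeff.
- rewrite sin.unlock; exact: is_cvg_series_sin_coeff.
Qed.

Lemma evolve_diag n (h : 'I_n -> R) (t : R) (rho : 'M[C]_n) :
  evolve (diag_mx (\row_j (h j)%:C)) t rho =
  diag_mx (\row_j cis (- (t * h j))) *m rho *m diag_mx (\row_j cis (t * h j)).
Proof.
have scale_diag (s : R) : ('i%C * s%:C) *: diag_mx (\row_j (h j)%:C) =
    diag_mx (\row_j ('i%C * (s * h j)%:C)) :> 'M[C]_n.
  apply/matrixP => i j; rewrite !mxE rmorphM mulrA.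
  by case: eqP => _; rewrite ?mulr0n ?mulr0 ?mulr1n.
rewrite /evolve -complexiE scale_diag expmx_diag.
have -> : - ('i%C * t%:C) = 'i%C * (- t)%:C :> C by rewrite rmorphN mulrN.
rewrite scale_diag expmx_diag; congr (diag_mx _ *m _ *m _).
by apply/rowP => j; rewrite !mxE mulNr.
Qed.

End UnitaryEvolution.

(** * Positive semidefinite matrices and covariant channels *)

Section PositiveSemidefinite.
Variable C : numClosedFieldType.

Lemma psdmx_gram m n (B : 'M[C]_(m, n)) : psdmx (B ^t* *m B).
Proof.
move=> v; rewrite mulmxA -mulmxA -map_mxM -trmx_mul mxE.
by apply: sumr_ge0 => k _; rewrite !mxE mulrC mul_conjC_ge0.
Qed.

Lemma psdmx2 n (A : 'M[C]_n) i j (z w : C) : psdmx A ->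
  0 <= z^* * z * A i i + z^* * w * A i j + w^* * z * A j i + w^* * w * A j j.
Proof.
move=> /(_ (z *: delta_mx i 0 + w *: delta_mx j 0)).
have ent (k l : 'I_n) : (delta_mx k 0 : 'cV[C]_n)^t* *m A *m (delta_mx l 0 :
  'cV[C]_n) = (A k l)%:M.
  apply/matrixP => a b; rewrite !ord1 trmx_delta map_delta_mx -rowE -colE !mxE.
  by rewrite mulr1n.
have -> : (z *: delta_mx i 0 + w *: delta_mx j 0 : 'cV[C]_n)^t* =
    z^* *: (delta_mx i 0)^t* + w^* *: (delta_mx j 0)^t*.
  by apply/matrixP => a b; rewrite !mxE rmorphD !rmorphM.
rewrite !mulmxDl -!scalemxAl.
rewrite !mulmxDr -!scalemxAr !ent !mxE !mulr1n.
by move=> h; rewrite (le_trans h) // le_eqVlt; apply/orP; left; apply/eqP; ring.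
Qed.

Lemma psdmx_diag_ge0 n (A : 'M[C]_n) i : psdmx A -> 0 <= A i i.
Proof.
by move=> /(@psdmx2 _ _ i i 1 0);
  rewrite conjC0 conjC1 !mul0r !mulr0 !mul0r !mul1r !addr0.
Qed.

(** Polarisation: the form is real at [e_i + e_j] and at [e_i + 'i e_j]. Adding the two resulting
    equations isolates the conjugate of [A i j]. *)
Lemma psdmx_conj n (A : 'M[C]_n) i j : psdmx A -> (A i j)^* = A j i.
Proof.
move=> pA.
have e1 := CrealP (ger0_real (psdmx2 i j 1 1 pA)).
have e2 := CrealP (ger0_real (psdmx2 i j 1 'i pA)).
have ai := CrealP (ger0_real (psdmx_diag_ge0 i pA)).
have aj := CrealP (ger0_real (psdmx_diag_ge0 j pA)).
set x := A i j in e1 e2 *; set y := A j i in e1 e2 *.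
have {}e1 : x^* + y^* = x + y.
  have -> : x + y = (1^* * 1 * A i i + 1^* * 1 * x + 1^* * 1 * y + 1^* * 1 * A
    j j) - A i i - A j j.
    by rewrite conjC1; ring.
  rewrite -[in RHS]e1 !rmorphD !rmorphM /= !conjC1 ai aj; ring.
have {}e2 : x^* - y^* = y - x.
  have ii : 'i * 'i = -1 :> C by rewrite -expr2 sqrCi.
  have -> : y - x = 'i * ((1^* * 1 * A i i + 1^* * 'i * x + 'i^* * 1 * y + 'i^*
    * 'i * A j j) - A i i - A j j).
    rewrite conjC1 conjCi; ring: ii.
  rewrite -[in RHS]e2 !rmorphD !rmorphM /= !conjC1 !conjCi ai aj rmorphN /=
    conjCi; ring: ii.
have : 2 * x^* = 2 * y by rewrite -[LHS]/(2 * x^*); have := congr2 +%R e1 e2;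
  rewrite addrACA subrr addr0 => h; rewrite mulr2n mulrDl mul1r h; ring.
by move/mulfI; apply; rewrite pnatr_eq0.
Qed.

Lemma psdmx_hermsym n (A : 'M[C]_n) : psdmx A -> A \is hermsymmx.
Proof.
move=> pA; apply/is_hermitianmxP; rewrite expr0 scale1r.
by apply/matrixP => i j; rewrite !mxE psdmx_conj.
Qed.

Lemma psdmx_factor n (A : 'M[C]_n) : psdmx A -> exists B : 'M[C]_n, A = B^t* *m B.
Proof.
move=> pA; have Pu := spectral_unitarymx A.
have := orthomx_spectralP (hermitian_normalmx (psdmx_hermsym pA)).
set P := spectralmx A in Pu *; set d := spectral_diag A => Ad.
(* Each eigenvalue is the value of the form at a unit eigenvector, a column of the adjoint of
   [P]. *)
have dge i : 0 <= d 0 i.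
  have := pA (P^t* *m delta_mx i 0); rewrite Ad (invmx_unitary Pu).
  rewrite trmx_mul map_mxM trmxCK !mulmxA !(mulmxtVK _ Pu).
  by rewrite trmx_delta map_delta_mx -rowE -colE !mxE eqxx.
exists (diag_mx (map_mx sqrtC d) *m P).
rewrite trmx_mul map_mxM tr_diag_mx map_diag_mx.
rewrite mulmxA -[_ *m _ *m diag_mx _]mulmxA mulmx_diag -(invmx_unitary Pu) {1}Ad.
congr (_ *m diag_mx _ *m _); apply/rowP => i; rewrite !mxE.
by rewrite -[Num.Num_conj__canonical__GRing_RMorphism C _]/((sqrtC (d 0 i))^*)
  (CrealP (ger0_real _)) ?sqrtC_ge0 // -expr2 sqrtCK.
Qed.

Lemma psdmx0 n : psdmx (0 : 'M[C]_n).
Proof. by move=> v; rewrite mulmx0 mul0mx mxE. Qed.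

Lemma psdmxD n (A B : 'M[C]_n) : psdmx A -> psdmx B -> psdmx (A + B).
Proof. by move=> pA pB v; rewrite mulmxDr mulmxDl mxE addr_ge0. Qed.

Lemma psdmx_sum (I : Type) (r : seq I) (P : pred I) n (F : I -> 'M[C]_n) :
  (forall i, P i -> psdmx (F i)) -> psdmx (\sum_(i <- r | P i) F i).
Proof. by move=> pF; elim/big_ind: _ => //; [exact: psdmx0|exact: psdmxD]. Qed.

Lemma psdmxZ n (a : C) (A : 'M[C]_n) : 0 <= a -> psdmx A -> psdmx (a *: A).
Proof. by move=> a0 pA v; rewrite -scalemxAr -scalemxAl mxE mulr_ge0. Qed.

Lemma psdmx_congr m n (K : 'M[C]_(m, n)) (A : 'M[C]_n) :
  psdmx A -> psdmx (K *m A *m K^t*).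
Proof.
move=> pA v; have := pA (K^t* *m v).
by rewrite trmx_mul map_mxM trmxCK !mulmxA.
Qed.

Lemma psdmx_tens m n (A : 'M[C]_m) (B : 'M[C]_n) :
  psdmx A -> psdmx B -> psdmx (A *t B).
Proof.
move=> /psdmx_factor[A' ->] /psdmx_factor[B' ->].
by rewrite -tensmx_mul -map_mxT -trmx_tens; exact: psdmx_gram.
Qed.

Lemma psdmx_ptrace1 m n (X : 'M[C]_(m * n)) : psdmx X -> psdmx (ptrace1 X).
Proof.
move=> /psdmx_factor[B ->].
have -> : ptrace1 (B^t* *m B) = \sum_c
    (\matrix_(k, a) B k (mxtens_index (c, a)))^t* *m \matrix_(k, a) B k
      (mxtens_index (c, a)).
  apply/matrixP => a b; rewrite mxE summxE; apply: eq_bigr => c _.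
  by rewrite !mxE; apply: eq_bigr => k _; rewrite !mxE.
by apply: psdmx_sum => c _; exact: psdmx_gram.
Qed.

Lemma psdmx_ptrace2 m n (X : 'M[C]_(m * n)) : psdmx X -> psdmx (ptrace2 X).
Proof.
move=> /psdmx_factor[B ->].
have -> : ptrace2 (B^t* *m B) = \sum_c
    (\matrix_(k, a) B k (mxtens_index (a, c)))^t* *m \matrix_(k, a) B k
      (mxtens_index (a, c)).
  apply/matrixP => a b; rewrite mxE summxE; apply: eq_bigr => c _.
  by rewrite !mxE; apply: eq_bigr => k _; rewrite !mxE.
by apply: psdmx_sum => c _; exact: psdmx_gram.
Qed.

Lemma sum_mxtens (V : nmodType) m n (F : 'I_(m * n) -> V) :
  \sum_u F u = \sum_i \sum_j F (mxtens_index (i, j)).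
Proof.
rewrite pair_big (reindex (@mxtens_index m n)) /=.
  by apply: eq_bigr => -[i j] _.
by exists (@mxtens_unindex m n) => u _; rewrite (mxtens_indexK, mxtens_unindexK).
Qed.

Lemma tr_ptrace1 m n (X : 'M[C]_(m * n)) : \tr (ptrace1 X) = \tr X.
Proof.
rewrite /mxtrace sum_mxtens exchange_big /=.
by apply: eq_bigr => i _; rewrite mxE.
Qed.

Lemma tr_ptrace2 m n (X : 'M[C]_(m * n)) : \tr (ptrace2 X) = \tr X.
Proof. by rewrite /mxtrace sum_mxtens; apply: eq_bigr => i _; rewrite mxE. Qed.

Lemma tr_tens m n (A : 'M[C]_m) (B : 'M[C]_n) : \tr (A *t B) = \tr A * \tr B.
Proof.
rewrite /mxtrace sum_mxtens mulr_suml; apply: eq_bigr => i _.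
by rewrite mulr_sumr; apply: eq_bigr => j _; rewrite tensmxE.
Qed.

End PositiveSemidefinite.

Section Kraus.
Variable C : numClosedFieldType.
Variables (I : finType) (m n : nat) (K : I -> 'M[C]_(n, m)).

Definition kraus (X : 'M[C]_m) : 'M[C]_n := \sum_i K i *m X *m (K i)^t*.

Lemma kraus_is_linear : linear kraus.
Proof.
move=> a X Y; rewrite /kraus scaler_sumr -big_split; apply: eq_bigr => i _ /=.
by rewrite mulmxDr mulmxDl -scalemxAr -scalemxAl.
Qed.

HB.instance Definition _ := GRing.isLinear.Build C 'M[C]_m 'M[C]_n _ kraus
  kraus_is_linear.

(** Factor the input as a Gram matrix of [B] and slice [B] along the ancilla label. Then [D i] is
    [B] times the adjoint of [K i] tensored with the identity, and the output is the sum of the Gram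
    matrices of the [D i]. *)
Lemma kraus_cp : completely_positive kraus.
Proof.
move=> k X /psdmx_factor[B ->].
pose Bc c := \matrix_(l, a) B l (mxtens_index (a, c)) : 'M[C]_(m * k, m).
pose D i := \matrix_(l, u) (Bc (mxtens_unindex u).2 *m (K i)^t*) l
  (mxtens_unindex u).1
  : 'M[C]_(m * k, n * k).
have -> : ampliation kraus (B^t* *m B) = \sum_i (D i)^t* *m D i.
  apply/matrixP => u v; rewrite mxE !summxE; apply: eq_bigr => i _.
  rewrite (_ : (\matrix_(a, b) _) =
    (Bc (mxtens_unindex u).2)^t* *m Bc (mxtens_unindex v).2); last first.
    by apply/matrixP => a b; rewrite !mxE; apply: eq_bigr => l _; rewrite !mxE.
  rewrite mulmxA -mulmxA -[K i *m _](trmxCK) trmx_mul map_mxM trmxCK.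
  rewrite [LHS]mxE [RHS]mxE; apply: eq_bigr => l _.
  by rewrite [in LHS]mxE [in LHS]mxE [(D i)^t* _ _]mxE [(D i)^T _ _]mxE !(mxE _
    _ l).
by apply: psdmx_sum => i _; exact: psdmx_gram.
Qed.

Lemma kraus_psd X : psdmx X -> psdmx (kraus X).
Proof. by move=> pX; apply: psdmx_sum => i _; exact: psdmx_congr. Qed.

Lemma kraus_tp : \sum_i (K i)^t* *m K i = 1%:M -> trace_preserving kraus.
Proof.
move=> KK X; rewrite /kraus raddf_sum /=.
under eq_bigr do rewrite mxtrace_mulC mulmxA.
by rewrite -raddf_sum -mulmx_suml KK mul1mx.
Qed.

End Kraus.

(** * Trace distance of a qubit state from the plus state *)

Section QubitTraceNorm.
Variable C : numClosedFieldType.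

(** Conjugation by the chosen diagonalising matrix fixes a scalar matrix, so every spectral
    eigenvalue is [s], whichever basis [spectralmx] selects. *)
Lemma trace_norm_scalar n (A : 'M[C]_n) (s : C) :
  A^t* *m A = s%:M -> trace_norm A = sqrtC s *+ n.
Proof.
move=> As; rewrite /trace_norm /sqrtmx As.
have Pu := spectral_unit (s%:M : 'M[C]_n).
have sherm : (s%:M : 'M[C]_n) \is normalmx.
  by apply/normalmxP; rewrite scalar_mxC.
have /orthomx_spectralP := sherm.
set P := spectralmx _ in Pu *; set d := spectral_diag _ => sP.
have dE : diag_mx d = s%:M.
  have := congr1 (fun X => P *m X *m invmx P) sP.
  by rewrite /= scalar_mxC mulmxK // !mulmxA mulmxV // mul1mx mulmxK.
have -> : diag_mx (map_mx sqrtC d) = (sqrtC s)%:M.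
  apply/matrixP => i j; rewrite !mxE; case: eqP => _;
    rewrite ?mulr0n // !mulr1n; congr sqrtC.
  by have /matrixP/(_ i i) := dE; rewrite !mxE eqxx !mulr1n.
by rewrite scalar_mxC mulmxKV // mxtrace_scalar.
Qed.

Lemma mx2P (A B : 'M[C]_2) : A 0 0 = B 0 0 -> A 0 1 = B 0 1 ->
  A 1 0 = B 1 0 -> A 1 1 = B 1 1 -> A = B.
Proof.
have ord2 (i : 'I_2) : (i = 0) \/ (i = 1).
  by case: i => [[|[|//]] hi]; [left|right]; apply: val_inj.
by move=> *; apply/matrixP => i j; case: (ord2 i) => ->; case: (ord2 j) => ->.
Qed.

Lemma sum_ord2 (V : nmodType) (F : 'I_2 -> V) : \sum_i F i = F 0 + F 1.
Proof.
by rewrite !big_ord_recl big_ord0 addr0; congr (_ + F _); apply: val_inj.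
Qed.

(** The form takes the values [r 1 1 * det] and [r 0 0 * det] at the two test vectors. Their sum is
    the trace times the determinant, so no division by a possibly zero diagonal entry occurs. *)
Lemma psdmx_det2_ge0 (r : 'M[C]_2) : is_state r -> r 0 1 * r 1 0 <= r 0 0 * r 1 1.
Proof.
move=> [pr]; rewrite /mxtrace sum_ord2.
move=> tr1.
have c01 := psdmx_conj 0 1 pr; have c10 := psdmx_conj 1 0 pr.
have c00 := psdmx_conj 0 0 pr; have c11 := psdmx_conj 1 1 pr.
have h1 := psdmx2 0 1 (r 1 1) (- r 1 0) pr.
have h2 := psdmx2 0 1 (- r 0 1) (r 0 0) pr.
rewrite -subr_ge0 -[X in 0 <= X]mul1r -tr1.
apply: le_trans (addr_ge0 h1 h2) _; rewrite le_eqVlt; apply/orP; left; apply/eqP.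
rewrite !rmorphN /= c01 c10 c00 c11; ring.
Qed.

(* (r - rho_plus)^2 is the scalar 1/2 - (r01 + r10)/2 - det r, and det r >= 0. *)
Lemma trace_norm_sub_rho_plus (r : 'M[C]_2) (e : C) : is_state r -> 0 <= e ->
  1 - (r 0 1 + r 1 0) <= e ^+ 2 / 2 -> trace_norm (r - rho_plus C) <= e.
Proof.
move=> sr e0 he; have [pr] := sr.
have hdet := psdmx_det2_ge0 sr.
rewrite /mxtrace sum_ord2.
move=> tr1; have r11 : r 1 1 = 1 - r 0 0 by rewrite -tr1 addrAC subrr add0r.
have c01 := psdmx_conj 0 1 pr; have c10 := psdmx_conj 1 0 pr.
have c00 := psdmx_conj 0 0 pr.
have c2 : (2^-1 : C)^* = 2^-1 by rewrite fmorphV rmorph_nat.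
pose s := (r 0 0 - 2^-1) ^+ 2 + (r 0 1 - 2^-1) * (r 1 0 - 2^-1).
have As : (r - rho_plus C)^t* *m (r - rho_plus C) = s%:M.
  have c11 := psdmx_conj 1 1 pr.
  by apply: mx2P; rewrite mxE sum_ord2 !mxE /= ?mulr1n ?mulr0n !rmorphB
    !rmorphM !rmorphD /=
     ?conjC0 ?conjC1 c2 ?c00 ?c01 ?c10 ?c11 ?r11 /s; field.
have s0 : 0 <= s.
  rewrite addr_ge0 //.
    by rewrite -realEsqr rpredB ?rpredV ?realn // ger0_real // psdmx_diag_ge0.
  by rewrite -c01 -{2}c2 -rmorphB mul_conjC_ge0.
rewrite (trace_norm_scalar As) -[e]sqrCK //.
have four0 : 0 <= 2 ^+ 2 :> C by rewrite exprn_ge0 ?ler0n.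
rewrite -(mulr_natl (sqrtC s)) -{1}[2%:R]sqrCK ?ler0n // -sqrtCM ?nnegrE //.
rewrite ler_sqrtC ?nnegrE ?exprn_ge0 ?mulr_ge0 //.
have -> : 2 ^+ 2 * s = 2 * (1 - (r 0 1 + r 1 0)) - 4 * (r 0 0 * r 1 1 - r 0 1 *
  r 1 0) :> C.
  by rewrite r11 /s; field.
rewrite (le_trans (_ : _ <= 2 * (1 - (r 0 1 + r 1 0)))) //.
  by rewrite gerBl mulr_ge0 ?ler0n // subr_ge0.
by rewrite mulrC -ler_pdivlMr ?ltr0n.
Qed.

End QubitTraceNorm.

Section CovariantKraus.
Local Open Scope complex_scope.
Variable R : realType.
Local Notation C := R[i].

(** A Kraus operator that shifts every energy by the same [w] commutes with the evolution up to the
    phase [cis (t * w)], which cancels against the phase from its adjoint. *)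
Lemma kraus_TIO (I : finType) n (h : 'I_n -> R) (K : I -> 'M[C]_n) :
  (forall a, exists w, forall i j, K a i j != 0 -> h i = h j + w) ->
  \sum_a (K a)^t* *m K a = 1%:M ->
  is_TIO (diag_mx (\row_j (h j)%:C)) (kraus K : {linear _ -> _}).
Proof.
move=> hK KK; split; [exact: kraus_cp|exact: kraus_tp|] => rho _ t.
rewrite !evolve_diag; set U := diag_mx _; set V := diag_mx _.
rewrite /kraus mulmx_sumr mulmx_suml; apply: eq_bigr => a _.
have [w hw] := hK a.
have KU : K a *m U = cis (t * w) *: (U *m K a).
  apply/matrixP => i j; rewrite /U mul_mx_diag mul_diag_mx !mxE.
  have [->|/hw ->] := eqVneq (K a i j) 0; first by rewrite mul0r !mulr0.
  by rewrite mulrA -cisD mulrC; congr (cis _ * _); ring.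
have VK : V *m (K a)^t* = cis (- (t * w)) *: ((K a)^t* *m V).
  apply/matrixP => i j; rewrite /V mul_mx_diag mul_diag_mx !mxE.
  have [->|/hw ->] := eqVneq (K a j i) 0; first by rewrite conjC0 mul0r !mulr0.
  by rewrite [_ * cis (t * (_ + _))]mulrC mulrA -cisD; congr (cis _ * _); ring.
rewrite !mulmxA KU -!mulmxA VK -scalemxAl -!scalemxAr scalerA -cisD subrr cis0.
by rewrite scale1r !mulmxA.
Qed.

End CovariantKraus.

(** * The phase-recording channel *)

Section Nodes.
Variable N : nat.

(* In a node (b, m), b is the record of outcomes and m the ladder level.  A step
   raises the level by at most 2, so no ladder boundary is ever reached. *)
Definition node := {x : {bseq N of 'I_4} * 'I_(2 * N).+1 | (x.2 <= 2 * size
  x.1)%N}.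
HB.instance Definition _ := Finite.on node.

Definition dimC := #|{: node}|.

Definition word (i : 'I_dimC) : seq 'I_4 := (val (enum_val i)).1.
Definition level (i : 'I_dimC) : nat := (val (enum_val i)).2.

Definition origin_node : node := exist _ ([bseq], ord0) isT.
Definition origin : 'I_dimC := enum_rank origin_node.

(** [insubd], [insub_bseq] and [inord] make this total through default values. By [childP] they are
    never taken when the record is not full and [a <= 2]. *)
Definition child (i : 'I_dimC) (j : 'I_4) (a : nat) : 'I_dimC :=
  enum_rank (insubd origin_node (insub_bseq N (rcons (word i) j), inord (level
    i + a))).

Lemma node_inj i i' : word i = word i' -> level i = level i' -> i = i'.
Proof.
move=> ww ll; apply: enum_val_inj; apply: val_inj; apply/eqP.
by rewrite -pair_eqE /pair_eq; apply/andP; split; apply/eqP; apply: val_inj.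
Qed.

Lemma size_word i : (size (word i) <= N)%N.
Proof. exact: size_bseq. Qed.

Lemma level_le i : (level i <= 2 * size (word i))%N.
Proof. exact: (valP (enum_val i)). Qed.

Lemma word_origin : word origin = [::].
Proof. by rewrite /word enum_rankK. Qed.

Lemma level_origin : level origin = 0%N.
Proof. by rewrite /level enum_rankK. Qed.

Lemma childP i j a : (size (word i) < N)%N -> (a <= 2)%N ->
  word (child i j a) = rcons (word i) j /\ level (child i j a) = (level i + a)%N.
Proof.
move=> sN a2; have li := level_le i.
rewrite /word /level /child enum_rankK.
have wE : val (insub_bseq N (rcons (word i) j)) = rcons (word i) j.
  by rewrite /insub_bseq val_insubd size_rcons sN.
have lE : (inord (level i + a) : 'I_(2 * N).+1) = (level i + a)%N :> nat.
  by rewrite inordK //; lia.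
rewrite val_insubd /= lE wE size_rcons.
by case: ifP => /=; [rewrite lE wE | lia].
Qed.

End Nodes.

Section Zeta.
Variable C : numClosedFieldType.

Definition zeta (j : 'I_4) : C := 'i ^+ j.

Lemma sum_zeta (F : C -> C) :
  \sum_j F (zeta j) = F 1 + F 'i + F (-1) + F (- 'i).
Proof.
rewrite /zeta !big_ord_recl big_ord0 addr0 /= /bump /= expr0 expr1 sqrCi.
by rewrite exprS sqrCi mulrN1 !addrA.
Qed.

(** Orthogonality of characters of Z/4: [s' - s] lies in {-1, 0, 1}, so it vanishes modulo 4 only if
    [s = s']. *)
Lemma sum_zeta_s (s s' : 'I_2) :
  \sum_j (zeta j)^* ^+ s * zeta j ^+ s' = (s == s')%:R *+ 4.
Proof.
rewrite (sum_zeta (fun z => z^* ^+ s * z ^+ s')) !rmorphN conjC1 conjCi.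
have ii : 'i * 'i = -1 :> C by rewrite -expr2 sqrCi.
rewrite -val_eqE; case: s s' => [[|[|//]] hs] [[|[|//]] hs'] /=.
all: rewrite ?expr0 ?expr1 ?conjC1 ?conjCi; ring: ii.
Qed.

End Zeta.

(** * One step in the Heisenberg picture *)

Section StepOperator.
Variables (C : numClosedFieldType) (N : nat) (c : seq 'I_4 -> 'I_2 -> C).
Local Notation d := (dimC N).
Local Notation zeta := (@zeta C).
Implicit Types (x y : 'I_d) (r s : 'I_2) (w : seq 'I_4 -> C) (q : int).

Definition growing x := (size (word x) < N)%N.

(* Matrix entry <r, y| K |s, x> of the isometry
   K |s, (b, m)> = 1/2 \sum_j conj(zeta_j)^s \sum_r c(bj, r) |r, (bj, m + s + 1
     - r)>,
   which conserves s + m up to the constant 1. *)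
Definition step_entry r y s x : C :=
  (growing x)%:R * \sum_j 2^-1 * (zeta j)^* ^+ s * c (rcons (word x) j) r
                            * (y == child x j (s + (1 - r)))%:R.

Definition stepmx : 'M[C]_(2 * d) := \matrix_(u, v)
  step_entry (mxtens_unindex u).1 (mxtens_unindex u).2
             (mxtens_unindex v).1 (mxtens_unindex v).2.

(** The matrix entry <x'| T^q |x> of a power of the ladder shift, which leaves the record alone. *)
Definition shifted q x x' := (word x == word x') && ((level x')%:Z == (level
  x)%:Z + q).

Lemma sum_step_entry (phi : 'I_d -> C) r s x :
  \sum_y phi y * step_entry r y s x =
  (growing x)%:R * \sum_j 2^-1 * (zeta j)^* ^+ s * c (rcons (word x) j) r
                            * phi (child x j (s + (1 - r))).
Proof.
rewrite /step_entry.
under eq_bigr do rewrite mulrCA mulr_sumr.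
rewrite -mulr_sumr exchange_big /=; congr (_ * _); apply: eq_bigr => j _.
rewrite (bigD1 (child x j (s + (1 - r)))) //= eqxx mulr1 big1 ?addr0 1?mulrC //.
by move=> y /negbTE ->; rewrite !mulr0.
Qed.

Lemma shifted_child q x j a x' j' a' : growing x -> growing x' -> (a <= 2)%N ->
  (a' <= 2)%N ->
  shifted q (child x j a) (child x' j' a') =
  [&& j == j', word x == word x' & (level x' + a')%:Z == (level x + a)%:Z + q].
Proof.
move=> gx gx' ha ha'; rewrite /shifted.
have [-> ->] := childP j gx ha; have [-> ->] := childP j' gx' ha'.
by rewrite eqseq_rcons andbA [(j == _) && _]andbC.
Qed.

(** Pull-back of [w T^q] through one step. On the ladder the step is built from powers of T, so a
    power of T results: absorption adds [s - s'] to the exponent, emission adds [rb - ra]. The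
    weight is averaged over the new letter [j]. *)
Lemma sum_shifted_step q w ra rb s x s' x' :
  \sum_y \sum_y' (shifted q y y')%:R * w (word y) *
     (step_entry ra y s x * (step_entry rb y' s' x')^*) =
  (growing x && growing x')%:R * (shifted (q + s%:Z - s'%:Z + rb%:Z - ra%:Z) x
    x')%:R *
  \sum_j 4^-1 * ((zeta j)^* ^+ s * zeta j ^+ s') *
      (c (rcons (word x) j) ra * (c (rcons (word x) j) rb)^*) * w (rcons (word
        x) j).
Proof.
have ord2le (r : 'I_2) : (r <= 1)%N by rewrite -ltnS.
have h2 (k r : 'I_2) : (k + (1 - r) <= 2)%N by have := ord2le k; lia.
(* Moving the conjugation outside the inner sum lets [sum_step_entry] collapse first the sum over
   [y'], then that over [y]. *)
transitivity (\sum_y (\sum_y' ((shifted q y y')%:R * w (word y) : C)^* *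
  step_entry rb y' s' x')^* * step_entry ra y s x).
  apply: eq_bigr => y _; rewrite rmorph_sum mulr_suml; apply: eq_bigr => y' _.
  by rewrite rmorphM /= conjCK; ring.
under eq_bigr do rewrite sum_step_entry.
rewrite sum_step_entry.
case gx : (growing x); last by rewrite !mul0r.
case gx' : (growing x'); last first.
  by rewrite mul1r andbF !mul0r big1 // => j _; rewrite mul0r conjC0 mulr0.
rewrite !mul1r mulr_sumr; apply: eq_bigr => j _.
(* T preserves records, so cross terms between different new letters vanish. *)
rewrite mul1r rmorph_sum (bigD1 j) //= big1 ?addr0; last first.
  move=> j' jj'; rewrite shifted_child // eq_sym (negbTE jj') /=.
  by rewrite !(mul0r, conjC0, mulr0).
rewrite shifted_child // eqxx /= (proj1 (childP j gx _)) //.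
have -> : (word x == word x') &&
   ((level x' + (s' + (1 - rb)))%:Z == (level x + (s + (1 - ra)))%:Z + q)
   = shifted (q + s%:Z - s'%:Z + rb%:Z - ra%:Z) x x'.
  rewrite /shifted; congr (_ && _).
  have := ord2le ra; have := ord2le rb; move=> hrb hra.
  by apply/eqP/eqP; lia.
case: (boolP (shifted _ x x')) => [/andP[/eqP wE _]|_]; last first.
  by rewrite !(mul0r, conjC0, mulr0).
rewrite -wE !rmorphM !rmorphXn /= !conjCK fmorphV rmorph_nat.
have -> : (4 : C)^-1 = 2^-1 * 2^-1 by rewrite -invfM -natrM.
by ring.
Qed.

End StepOperator.

Section Correlators.
Variables (C : numClosedFieldType) (N : nat) (c : seq 'I_4 -> 'I_2 -> C).
Local Notation d := (dimC N).
Local Notation zeta := (@zeta C).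
Implicit Types (x y : 'I_d) (r s : 'I_2) (w : seq 'I_4 -> C) (q : int).
Hypothesis c_unit : forall b, b != [::] -> \sum_r c b r * (c b r)^* = 1.

Lemma shifted0 x x' : shifted 0 x x' = (x == x').
Proof.
rewrite /shifted addr0; apply/andP/eqP => [[/eqP ww /eqP[ll]]|->]; last by [].
exact: node_inj.
Qed.

Lemma sum_shifted0 (F : 'I_d -> 'I_d -> C) :
  \sum_x \sum_x' (shifted 0 x x')%:R * F x x' = \sum_x F x x.
Proof.
apply: eq_bigr => x _; rewrite (bigD1 x) //= shifted0 eqxx mul1r big1 ?addr0 //.
by move=> x' nx; rewrite shifted0 eq_sym (negbTE nx) mul0r.
Qed.

Lemma rcons_neq0 (T : eqType) (s : seq T) a : rcons s a != [::].
Proof. by case: s. Qed.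

Lemma sum_zeta_s4 s s' :
  \sum_j 4^-1 * ((zeta j)^* ^+ s * zeta j ^+ s') = (s == s')%:R.
Proof.
by rewrite -mulr_sumr sum_zeta_s mulrnAr -mulrnAl -(mulr_natr 4^-1) mulVf
  ?mul1r // pnatr_eq0.
Qed.

(** [sum_shifted_step] with [q = 0], [w = 1] and [ra = rb]. The sum over [r] is 1 by normalisation,
    and the character sum removes the overlap of inputs with different qubit labels. What remains is
    the projection onto the nodes that can still grow. *)
Lemma stepmx_gram u v : ((stepmx N c)^t* *m stepmx N c) u v =
  ((u == v) && growing (mxtens_unindex v).2)%:R.
Proof.
case: (mxtens_indexP u) => s x; case: (mxtens_indexP v) => s' x'.
rewrite mxE sum_mxtens mxtens_indexK /=.
transitivity (\sum_r \sum_y \sum_y' (shifted 0 y y')%:R * 1 *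
    (step_entry c r y s' x' * (step_entry c r y' s x)^*)).
  apply: eq_bigr => r _; under [RHS]eq_bigr do under eq_bigr do rewrite mulr1.
  rewrite (sum_shifted0 (fun y y' => step_entry c r y s' x' * (step_entry c r
    y' s x)^*)).
  by apply: eq_bigr => y _; rewrite !mxE !mxtens_indexK mulrC.
under eq_bigr do rewrite (sum_shifted_step c _ (fun _ => 1)).
under eq_bigr do rewrite addrK.
under eq_bigr do under eq_bigr do rewrite mulr1.
rewrite -mulr_sumr exchange_big /=.
under eq_bigr do rewrite -mulr_sumr c_unit ?rcons_neq0 // mulr1.
rewrite sum_zeta_s4 add0r.
have -> : (mxtens_index (s, x) == mxtens_index (s', x')) = (s == s') && (x == x').
  by rewrite (can_eq (@mxtens_indexK _ _)) -pair_eqE.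
have [->|ss] := eqVneq s s'; last by rewrite mulr0.
rewrite subrr shifted0 ?eqxx mulr1 /= [x' == x]eq_sym.
by have [->|] := eqVneq x x'; rewrite ?mulr0 //= andbb mulr1.
Qed.

(* The rank-one operators reset the nodes whose record is full. *)
Definition kraus_op (a : unit + 'I_(2 * d)) : 'M[C]_(2 * d) :=
  match a with
  | inl _ => stepmx N c
  | inr v => if growing (mxtens_unindex v).2 then 0
             else delta_mx (mxtens_index (0, origin N)) v
  end.

(** The resets supply the complementary projection, onto nodes with a full record. *)
Lemma kraus_op_tp : \sum_a (kraus_op a)^t* *m kraus_op a = 1%:M.
Proof.
rewrite big_sumType /= big_const cardT enumT unlock /= addr0.
apply/matrixP => u v; rewrite mxE stepmx_gram summxE [RHS]mxE.
rewrite (bigD1 v) //= big1 ?addr0.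
  case: ifP => _; first by rewrite mulmx0 [X in _ + X]mxE addr0 andbT.
  by rewrite trmx_delta map_delta_mx mul_delta_mx mxE eqxx !andbT andbF add0r.
move=> v' nv; case: ifP => _; first by rewrite mulmx0 mxE.
rewrite trmx_delta map_delta_mx mul_delta_mx mxE.
by rewrite [v == v']eq_sym (negbTE nv) andbF.
Qed.

(* The expectation of w(b) T^q in the catalyst state om, T being the raising ladder shift. *)
Definition corr q w (om : 'M[C]_d) : C :=
  \sum_x \sum_x' (shifted q x x')%:R * w (word x) * om x x'.

Definition depth k (om : 'M[C]_d) : Prop :=
  forall x x', om x x' != 0 -> size (word x) = k /\ size (word x') = k.

Lemma eq_corr k q w w' om : depth k om ->
  (forall b, size b = k -> w b = w' b) -> corr q w om = corr q w' om.
Proof.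
move=> dk ww; apply: eq_bigr => x _; apply: eq_bigr => x' _.
have [->|/dk[sx _]] := eqVneq (om x x') 0; first by rewrite !mulr0.
by rewrite ww.
Qed.

Lemma corrD q w w' om : corr q (fun b => w b + w' b) om = corr q w om + corr q
  w' om.
Proof.
rewrite /corr -big_split; apply: eq_bigr => x _; rewrite -big_split.
by apply: eq_bigr => x' _ /=; rewrite mulrDr mulrDl.
Qed.

Lemma corrZ q a w om : corr q (fun b => a * w b) om = a * corr q w om.
Proof.
rewrite /corr mulr_sumr; apply: eq_bigr => x _; rewrite mulr_sumr.
by apply: eq_bigr => x' _ /=; ring.
Qed.

Lemma corr_sum (J : finType) q (w : J -> seq 'I_4 -> C) om :
  \sum_j corr q (w j) om = corr q (fun b => \sum_j w j b) om.
Proof.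
rewrite /corr exchange_big; apply: eq_bigr => x _ /=; rewrite exchange_big.
by apply: eq_bigr => x' _ /=; rewrite mulr_sumr mulr_suml.
Qed.

Lemma corr_tr om : corr 0 (fun=> 1) om = \tr om.
Proof.
rewrite /corr; under eq_bigr do under eq_bigr do rewrite mulr1.
exact: (sum_shifted0 (fun x x' => om x x')).
Qed.

Definition branch_avg ra rb s s' w b : C :=
  \sum_j 4^-1 * ((zeta j)^* ^+ s * zeta j ^+ s') *
    (c (rcons b j) ra * (c (rcons b j) rb)^*) * w (rcons b j).

Lemma stepmx_congrE (Y : 'M[C]_(2 * d)) u v :
  (stepmx N c *m Y *m (stepmx N c)^t*) u v =
  \sum_a \sum_b Y a b * (stepmx N c u a * (stepmx N c v b)^*).
Proof.
rewrite mxE exchange_big; apply: eq_bigr => b _; rewrite mxE mulr_suml.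
by apply: eq_bigr => a _; rewrite !mxE; ring.
Qed.

(** [sum_shifted_step] weighted by the entries of the product state. Since the depth is below [N],
    every node in the support can grow. *)
Lemma corr_blocks (rho : 'M[C]_2) om k ra rb q w : (k < N)%N -> depth k om ->
  \sum_y \sum_y' (shifted q y y')%:R * w (word y) *
    (stepmx N c *m (rho *t om) *m (stepmx N c)^t*)
      (mxtens_index (ra, y)) (mxtens_index (rb, y')) =
  \sum_s \sum_s' rho s s' *
    corr (q + s%:Z - s'%:Z + rb%:Z - ra%:Z) (branch_avg ra rb s s' w) om.
Proof.
move=> kN dk.
transitivity (\sum_a \sum_b (rho *t om) a b * \sum_y \sum_y'
   (shifted q y y')%:R * w (word y) *
   (stepmx N c (mxtens_index (ra, y)) a * (stepmx N c (mxtens_index (rb, y'))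
     b)^*)).
  under eq_bigr do under eq_bigr do rewrite stepmx_congrE mulr_sumr.
  under eq_bigr do rewrite exchange_big.
  rewrite exchange_big; apply: eq_bigr => a _ /=.
  under eq_bigr do under eq_bigr do rewrite mulr_sumr.
  under eq_bigr do rewrite exchange_big.
  rewrite exchange_big; apply: eq_bigr => b _ /=.
  rewrite mulr_sumr; apply: eq_bigr => y _; rewrite mulr_sumr.
  by apply: eq_bigr => y' _; ring.
rewrite sum_mxtens; apply: eq_bigr => s _.
under eq_bigr do rewrite sum_mxtens.
rewrite exchange_big; apply: eq_bigr => s' _ /=.
rewrite mulr_sumr; apply: eq_bigr => x _; rewrite mulr_sumr;
  apply: eq_bigr => x' _.
rewrite tensmxE -mulrA; congr (_ * _).
have [->|/dk[sx sx']] := eqVneq (om x x') 0; first by rewrite mul0r mulr0.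
rewrite mulrC; congr (_ * _).
under eq_bigr do under eq_bigr do rewrite !mxE !mxtens_indexK /=.
by rewrite sum_shifted_step /growing sx sx' kN mul1r.
Qed.

End Correlators.

(** * Evolution of the catalyst over one period *)

Section Dynamics.
Variables (C : numClosedFieldType) (N : nat) (c : seq 'I_4 -> 'I_2 -> C).
Local Notation d := (dimC N).
Local Notation zeta := (@zeta C).
Implicit Types (x y : 'I_d) (r s : 'I_2) (w : seq 'I_4 -> C) (q : int).
Hypothesis c_unit : forall b, b != [::] -> \sum_r c b r * (c b r)^* = 1.
Variable rho : 'M[C]_2.
Hypothesis rho_state : is_state rho.

Definition channel : 'M[C]_(2 * d) -> 'M[C]_(2 * d) := kraus (@kraus_op C N c).

Definition catalyst_map (om : 'M[C]_d) : 'M[C]_d := ptrace1 (channel (rho *t om)).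

Lemma delta_mx_congr n (Y : 'M[C]_n) (u v : 'I_n) :
  (delta_mx u v : 'M[C]_n) *m Y *m (delta_mx u v)^t* = Y v v *: delta_mx u u.
Proof.
rewrite trmx_delta map_delta_mx; apply/matrixP => a b.
rewrite !mxE (bigD1 v) //= big1 ?addr0.
  rewrite !mxE (bigD1 v) //= big1 ?addr0.
    rewrite !mxE !eqxx andbT /=.
    by case: (a == u); case: (b == u); rewrite /= ?(mul0r, mulr0, mul1r, mulr1).
  by move=> v' nv; rewrite !mxE (negbTE nv) andbF mul0r.
by move=> v' nv; rewrite !mxE (negbTE nv) mulr0.
Qed.

Lemma channelE (Y : 'M[C]_(2 * d)) :
  channel Y = stepmx N c *m Y *m (stepmx N c)^t* +
    (\sum_s \sum_x (~~ growing x)%:R * Y (mxtens_index (s, x)) (mxtens_index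
      (s, x))) *:
      delta_mx (mxtens_index (0, origin N)) (mxtens_index (0, origin N)).
Proof.
rewrite /channel /kraus big_sumType; congr (_ + _).
  by rewrite (bigD1 tt) //= big1 ?addr0 // => -[].
rewrite sum_mxtens scaler_suml; apply: eq_bigr => s _.
rewrite scaler_suml; apply: eq_bigr => x _.
rewrite /kraus_op mxtens_indexK /=; case: ifP => gx.
  by rewrite !mul0mx mul0r scale0r.
by rewrite delta_mx_congr mul1r.
Qed.

Lemma channel_growing k om : (k < N)%N -> depth k om ->
  channel (rho *t om) = stepmx N c *m (rho *t om) *m (stepmx N c)^t*.
Proof.
move=> kN dk; rewrite channelE big1 ?scale0r ?addr0 // => s _;
  rewrite big1 // => x _.
rewrite tensmxE; have [->|/dk[sx _]] := eqVneq (om x x) 0;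
  first by rewrite !mulr0.
by rewrite /growing sx kN mul0r.
Qed.

(** The step operator annihilates full records, so only the resets act, and they send all the weight
    to qubit label 0 and the origin. *)
Lemma channel_final om : depth N om ->
  channel (rho *t om) = \tr om *: delta_mx (mxtens_index (0, origin N))
    (mxtens_index (0, origin N)).
Proof.
move=> dN; rewrite channelE.
have -> : stepmx N c *m (rho *t om) *m (stepmx N c)^t* = 0.
  apply/matrixP => u v; rewrite stepmx_congrE [RHS]mxE.
  rewrite big1 // => a _; rewrite big1 // => b _.
  case: (mxtens_indexP a) => s x; case: (mxtens_indexP b) => s' x';
    rewrite tensmxE.
  have [->|/dN[sx _]] := eqVneq (om x x') 0; first by rewrite mulr0 mul0r.
  by rewrite [stepmx _ _ _ _]mxE /step_entry mxtens_indexK /= /growing sx ltnn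
    !mul0r mulr0.
have -> : \tr om = \tr (rho *t om) by rewrite tr_tens (proj2 rho_state) mul1r.
rewrite add0r /mxtrace sum_mxtens.
congr (_ *: _); apply: eq_bigr => s _; apply: eq_bigr => x _.
rewrite tensmxE; have [->|/dN[sx _]] := eqVneq (om x x) 0;
  first by rewrite !mulr0.
by rewrite /growing sx ltnn mul1r.
Qed.

Lemma step_entry_size r y s x : step_entry c r y s x != 0 ->
  size (word y) = (size (word x)).+1.
Proof.
rewrite /step_entry; case gx: (growing x); last by rewrite mul0r eqxx.
apply: contraNeq => ny; rewrite big1 ?mulr0 // => j _.
case: eqP => [yE|_]; last by rewrite mulr0.
move: ny; rewrite yE (proj1 (childP _ _ _)) ?size_rcons ?eqxx //.
by case: s {yE} => [[|[|//]] hs] /=; case: r => [[|[|//]] hr].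
Qed.

Lemma depth_catalyst_map k om : (k < N)%N -> depth k om -> depth k.+1
  (catalyst_map om).
Proof.
move=> kN dk y y'; apply: contra_neqP => ny;
  rewrite /catalyst_map mxE big1 // => r _.
rewrite (channel_growing kN dk) stepmx_congrE big1 // => a _;
  rewrite big1 // => b _.
case: (mxtens_indexP a) => s x; case: (mxtens_indexP b) => s' x'; rewrite tensmxE.
have [->|/dk[sx sx']] := eqVneq (om x x') 0; first by rewrite mulr0 mul0r.
rewrite ![stepmx _ _ _ _]mxE !mxtens_indexK /=.
have [->|/step_entry_size sy] := eqVneq (step_entry c r y s x) 0;
  first by rewrite mul0r mulr0.
have [->|/step_entry_size sy'] := eqVneq (step_entry c r y' s' x') 0;
  first by rewrite conjC0 !mulr0.
by case: ny; rewrite sy sy' sx sx'.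
Qed.

Lemma psdmx_catalyst_map om : psdmx om -> psdmx (catalyst_map om).
Proof.
by move=> po; apply/psdmx_ptrace1/kraus_psd/psdmx_tens => //; case: rho_state.
Qed.

Lemma tr_catalyst_map om : \tr (catalyst_map om) = \tr om.
Proof.
rewrite /catalyst_map tr_ptrace1 /channel kraus_tp; last exact: kraus_op_tp.
by rewrite tr_tens (proj2 rho_state) mul1r.
Qed.

Definition shift_avg s s' w b : C :=
  \sum_j 4^-1 * ((zeta j)^* ^+ s * zeta j ^+ s') * w (rcons b j).

(** Tracing out the emitted qubit sets [ra = rb], and normalisation removes the amplitudes [c]. The
    recursion for correlators is therefore the same for every choice of [c]. *)
Lemma corr_step k om q w : (k < N)%N -> depth k om ->
  corr q w (catalyst_map om) = \sum_s \sum_s' rho s s' * corr (q + s%:Z -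
    s'%:Z) (shift_avg s s' w) om.
Proof.
move=> kN dk; rewrite [LHS]/corr /catalyst_map (channel_growing kN dk).
transitivity (\sum_r \sum_y \sum_y' (shifted q y y')%:R * w (word y) *
    (stepmx N c *m (rho *t om) *m (stepmx N c)^t*)
      (mxtens_index (r, y)) (mxtens_index (r, y'))).
  rewrite [RHS]exchange_big; apply: eq_bigr => y _ /=.
  by rewrite [RHS]exchange_big; apply: eq_bigr => y' _ /=; rewrite mxE mulr_sumr.
under eq_bigr do rewrite (corr_blocks _ _ _ _ _ _ kN dk).
rewrite exchange_big; apply: eq_bigr => s _; rewrite exchange_big;
  apply: eq_bigr => s' _ /=.
rewrite -mulr_sumr; congr (_ * _).
under eq_bigr do rewrite addrK.
rewrite corr_sum; congr (corr _ _ om); apply/funext => b.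
rewrite exchange_big; apply: eq_bigr => j _ /=.
by rewrite -mulr_suml -mulr_sumr c_unit ?mulr1 // rcons_neq0.
Qed.

(** The amplitudes depend only on the record including the new letter, so the emitted qubit can be
    read off the catalyst after the step. The power [rb - ra] of T accounts for the energy exchanged
    with the ladder. *)
Lemma ptrace2_step k om ra rb : (k < N)%N -> depth k om ->
  ptrace2 (channel (rho *t om)) ra rb =
  corr (rb%:Z - ra%:Z) (fun b => c b ra * (c b rb)^*) (catalyst_map om).
Proof.
move=> kN dk; rewrite (corr_step _ _ kN dk) (channel_growing kN dk) mxE.
transitivity (\sum_y \sum_y' (shifted 0 y y')%:R * 1 *
    (stepmx N c *m (rho *t om) *m (stepmx N c)^t*)
      (mxtens_index (ra, y)) (mxtens_index (rb, y'))).
  under [RHS]eq_bigr do under eq_bigr do rewrite mulr1.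
  by rewrite (sum_shifted0 (fun y y' => (_ : 'M[C]_(2 * d)) (mxtens_index (ra,
    y)) (mxtens_index (rb, y')))).
rewrite (corr_blocks _ _ _ _ _ (fun=> 1) kN dk).
apply: eq_bigr => s _; apply: eq_bigr => s' _; congr (_ * _).
rewrite (_ : 0 + s%:Z - s'%:Z + rb%:Z - ra%:Z = rb%:Z - ra%:Z + s%:Z - s'%:Z);
  last by ring.
congr (corr _ _ om); apply/funext => b; apply: eq_bigr => j _.
by rewrite mulr1.
Qed.

Definition stage0 : 'M[C]_d := delta_mx (origin N) (origin N).
Definition stage k : 'M[C]_d := iter k catalyst_map stage0.

Lemma stage0_gram : stage0 = (delta_mx 0 (origin N) : 'rV[C]_d)^t* *m delta_mx
  0 (origin N).
Proof. by rewrite trmx_delta map_delta_mx mul_delta_mx. Qed.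

Lemma stage_psd k : psdmx (stage k).
Proof.
by elim: k => [|k IH]; [rewrite /= stage0_gram;
  exact: psdmx_gram | exact: psdmx_catalyst_map].
Qed.

Lemma stage_tr k : \tr (stage k) = 1.
Proof.
elim: k => [|k IH]; last by rewrite [stage _]/= tr_catalyst_map.
rewrite /mxtrace (bigD1 (origin N)) //= big1 ?addr0 ?mxE ?eqxx //.
by move=> x nx; rewrite mxE (negbTE nx).
Qed.

Lemma stage_depth k : (k <= N)%N -> depth k (stage k).
Proof.
elim: k => [_|k IH kN]; last by apply: depth_catalyst_map => //; exact/IH/ltnW.
move=> x x'; rewrite mxE; case: andP => [[/eqP-> /eqP->]|_]; last by rewrite eqxx.
by rewrite word_origin.
Qed.

Lemma ptrace1_delta (x x' : 'I_d) : ptrace1 (delta_mx (mxtens_index (0 : 'I_2,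
  x)) (mxtens_index (0, x'))) = delta_mx x x' :> 'M[C]_d.
Proof.
apply/matrixP => a b; rewrite !mxE sum_ord2 !mxE !(can_eq (@mxtens_indexK _ _)).
by rewrite -!pair_eqE /pair_eq /= addr0.
Qed.

(** After [N] steps all records are full, and one more application resets them: the period is
    [N.+1]. *)
Lemma stage_cycle : stage N.+1 = stage0.
Proof.
rewrite /stage iterS -/(stage N) /catalyst_map channel_final;
  last exact: stage_depth.
by rewrite stage_tr scale1r ptrace1_delta.
Qed.

End Dynamics.

(** * First and second moments of the record sum *)

Section Moments.
Variables (C : numClosedFieldType) (N : nat) (c : seq 'I_4 -> 'I_2 -> C).
Local Notation d := (dimC N).
Local Notation zeta := (@zeta C).
Implicit Types (x y : 'I_d) (r s : 'I_2) (w : seq 'I_4 -> C) (q : int).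
Hypothesis c_unit : forall b, b != [::] -> \sum_r c b r * (c b r)^* = 1.
Variable rho : 'M[C]_2.
Hypothesis rho_state : is_state rho.
Local Notation stage := (@stage C N c rho).

Definition wsum (b : seq 'I_4) : C := \sum_(j <- b) zeta j.

Lemma wsum_rcons b j : wsum (rcons b j) = wsum b + zeta j.
Proof. by rewrite /wsum -cats1 big_cat big_seq1. Qed.

Let ii : 'i * 'i = -1 :> C. Proof. by rewrite -expr2 sqrCi. Qed.

(** Besides the case [s = s'], only the term whose powers of zeta cancel survives. The case [s = 1],
    [s' = 0] leaves the average of zeta^(-2), which is zero for fourth roots of unity but would not
    be for signs. *)
Lemma shift_avg_wsum_conj s s' : shift_avg s s' (fun b => (wsum b)^*) =
  fun b => (s == s')%:R * (wsum b)^* + ((s == 0) && (s' == 1))%:R.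
Proof.
apply/funext => b; rewrite /shift_avg; under eq_bigr do rewrite wsum_rcons.
rewrite (sum_zeta (fun z => 4^-1 * (z^* ^+ s * z ^+ s') * (wsum b + z)^*)).
rewrite !rmorphD !rmorphN conjC1 conjCi -!val_eqE.
case: s s' => [[|[|//]] hs] [[|[|//]] hs'] /=.
all: rewrite ?rmorphD ?rmorphN ?conjC1 ?conjCi ?expr0 ?expr1; field: ii.
all: by [].
Qed.

Lemma shift_avg_wsum s s' : shift_avg s s' wsum =
  fun b => (s == s')%:R * wsum b + ((s == 1) && (s' == 0))%:R.
Proof.
apply/funext => b; rewrite /shift_avg; under eq_bigr do rewrite wsum_rcons.
rewrite (sum_zeta (fun z => 4^-1 * (z^* ^+ s * z ^+ s') * (wsum b + z))).
rewrite !rmorphN conjC1 conjCi -!val_eqE.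
case: s s' => [[|[|//]] hs] [[|[|//]] hs'] /=.
all: rewrite ?rmorphD ?rmorphN ?conjC1 ?conjCi ?expr0 ?expr1; field: ii.
all: by [].
Qed.

Lemma shift_avg_wsum_sq s s' : shift_avg s s' (fun b => wsum b * (wsum b)^*) =
  fun b => (s == s')%:R * (wsum b * (wsum b)^* + 1) +
    (((s == 1) && (s' == 0))%:R * (wsum b)^* + ((s == 0) && (s' == 1))%:R *
      wsum b).
Proof.
apply/funext => b; rewrite /shift_avg; under eq_bigr do rewrite wsum_rcons.
rewrite (sum_zeta (fun z => 4^-1 * (z^* ^+ s * z ^+ s') * ((wsum b + z) * (wsum
  b + z)^*))).
rewrite !rmorphD !rmorphN conjC1 conjCi -!val_eqE.
case: s s' => [[|[|//]] hs] [[|[|//]] hs'] /=.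
all: rewrite ?rmorphD ?rmorphN ?conjC1 ?conjCi ?expr0 ?expr1; field: ii.
all: by [].
Qed.

Lemma corr_stage0 q w : corr q w (stage0 C N) = (q == 0)%:R * w [::].
Proof.
rewrite /corr (bigD1 (origin N)) //= [X in _ + X]big1 ?addr0; last first.
  by move=> x nx; rewrite big1 // => x' _; rewrite mxE (negbTE nx) mulr0.
rewrite (bigD1 (origin N)) //= big1 ?addr0; last first.
  by move=> x nx; rewrite mxE (negbTE nx) andbF mulr0.
rewrite mxE !eqxx mulr1 word_origin /shifted eqxx level_origin /=.
by rewrite add0r eq_sym.
Qed.

Let tr_rho : rho 0 0 + rho 1 1 = 1.
Proof. by rewrite -(proj2 rho_state) /mxtrace sum_ord2. Qed.

Lemma corr_const q (e : C) (om : 'M[C]_d) : corr q (fun=> e) om = e * corr q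
  (fun=> 1) om.
Proof. by rewrite -corrZ; under [in RHS]eq_fun do rewrite mulr1. Qed.

Let rho11 : rho 1 1 = 1 - rho 0 0.
Proof. by rewrite -tr_rho addrAC subrr add0r. Qed.

Let corr_one k : corr 0 (fun=> 1) (stage k) = 1.
Proof. by rewrite corr_tr stage_tr. Qed.

(** Each step adds [rho 0 1]. The diagonal terms reproduce the correlator with weight the trace of
    [rho], and the term [s = 0], [s' = 1] cancels the shift, leaving the trace of the stage. *)
Lemma corr1_wsum k : (k <= N)%N -> corr 1 (fun b => (wsum b)^*) (stage k) =
  k%:R * rho 0 1.
Proof.
elim: k => [_|k IH kN]; first by rewrite corr_stage0 mul0r mul0r.
have dk : depth k (stage k) by exact/stage_depth/ltnW.
rewrite [stage _]/= (corr_step c_unit _ _ _ kN dk) !sum_ord2.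
rewrite !shift_avg_wsum_conj !corrD !corrZ /= !(subr0, addr0, addrK, subrr).
rewrite !(corr_const _ 0%:R) corr_one IH ?(ltnW kN) // rho11 -natr1; ring.
Qed.

Lemma corrN1_wsum k : (k <= N)%N -> corr (- 1) wsum (stage k) = k%:R * rho 1 0.
Proof.
elim: k => [_|k IH kN]; first by rewrite corr_stage0 mul0r mul0r.
have dk : depth k (stage k) by exact/stage_depth/ltnW.
rewrite [stage _]/= (corr_step c_unit _ _ _ kN dk) !sum_ord2.
rewrite !shift_avg_wsum !corrD !corrZ /= !(subr0, addr0, addrK, subrr).
rewrite !(corr_const _ 0%:R).
rewrite corr_one IH ?(ltnW kN) // rho11 -natr1; ring.
Qed.

(** The increment at step [k] is 1, from the new letter alone, plus two cross terms
    [k * rho 0 1 * rho 1 0] given by the first moments. *)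
Lemma corr0_wsum_sq k : (k <= N)%N ->
  corr 0 (fun b => wsum b * (wsum b)^*) (stage k) =
  k%:R + rho 0 1 * rho 1 0 * (k%:R ^+ 2 - k%:R).
Proof.
elim: k => [_|k IH kN].
  by rewrite corr_stage0 /wsum big_nil conjC0 !mul0r !mulr0 expr0n subrr mulr0
    addr0.
have dk : depth k (stage k) by exact/stage_depth/ltnW.
rewrite [stage _]/= (corr_step c_unit _ _ _ kN dk) !sum_ord2.
rewrite !shift_avg_wsum_sq !corrD !corrZ /= !(subr0, addr0, addrK, subrr, add0r).
rewrite !(corrD _ (fun b => wsum b * (wsum b)^*)) corr_one IH ?(ltnW kN) //.
rewrite corr1_wsum ?corrN1_wsum ?(ltnW kN) // rho11 -natr1; ring.
Qed.

End Moments.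

(** * Positivity of the weighted phase deviation *)

Section Positivity.
Variables (C : numClosedFieldType) (N : nat).
Local Notation d := (dimC N).
Implicit Types (x y : 'I_d) (w a s lam : seq 'I_4 -> C) (q : int).

Lemma psdmx_sum_ge0 n (A : 'M[C]_n) (v : 'I_n -> C) : psdmx A ->
  0 <= \sum_x \sum_x' (v x)^* * v x' * A x x'.
Proof.
move=> /(_ (\col_x v x)); rewrite mxE exchange_big /= => h.
apply: le_trans h _; rewrite le_eqVlt; apply/orP; left; apply/eqP.
apply: eq_bigr => x' _; rewrite !mxE mulr_suml; apply: eq_bigr => x _.
by rewrite !mxE; ring.
Qed.

Lemma sum_level (m m' : nat) : (m <= (2 * N).+1)%N ->
  \sum_(l < (2 * N).+2) ((m == l)%:R * (m' == l)%:R : C) = (m == m')%:R.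
Proof.
move=> hm; have hm' : (m < (2 * N).+2)%N by lia.
rewrite (bigD1 (Ordinal hm')) //= eqxx mul1r big1 ?addr0 1?eq_sym //.
by move=> l; rewrite -val_eqE /= eq_sym => /negbTE ->; rewrite mul0r.
Qed.

(* This is the positivity of lam |s - a T|^2, for which the form on each record
   is a sum over ladder levels of rank-one forms. *)
Lemma corr_quad_ge0 lam a s (om : 'M[C]_d) : psdmx om -> (forall b, 0 <= lam b) ->
  0 <= corr 0 (fun b => lam b * (a b * (a b)^* + s b * (s b)^*)) om
       - corr 1 (fun b => lam b * (a b * (s b)^*)) om
       - corr (- 1) (fun b => lam b * ((a b)^* * s b)) om.
Proof.
move=> pom lam0.
(* [v b l] is row [l] of [s T - a] on the record [b]. Raising the top level [2 * N] gives
   [2 * N + 1], so [l] takes one more value than the levels do and T loses nothing at the top. *)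
pose v (b : {bseq N of 'I_4}) (l : 'I_(2 * N).+2) x : C :=
  (word x == b)%:R * (((level x).+1 == l)%:R * s b - (level x == l)%:R * a b).
have h : 0 <= \sum_(b : {bseq N of 'I_4}) \sum_l lam b * \sum_x \sum_x' (v b l
  x)^* * v b l x' * om x x'.
  by apply: sumr_ge0 => b _; apply: sumr_ge0 => l _;
    rewrite mulr_ge0 ?psdmx_sum_ge0.
apply: le_trans h _; rewrite le_eqVlt; apply/orP; left; apply/eqP.
transitivity (\sum_x \sum_x' \sum_(b : {bseq N of 'I_4}) \sum_l lam b * ((v b l
  x)^* * v b l x' * om x x')).
  under eq_bigr do under eq_bigr do rewrite mulr_sumr.
  under eq_bigr do rewrite exchange_big.
  rewrite exchange_big; apply: eq_bigr => x _ /=.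
  under eq_bigr do under eq_bigr do rewrite mulr_sumr.
  under eq_bigr do rewrite exchange_big.
  by rewrite exchange_big.
rewrite /corr -!sumrB; apply: eq_bigr => x _; rewrite -!sumrB;
  apply: eq_bigr => x' _.
have hb : (size (word x) <= N)%N := size_word x.
have [bx bxE] : exists b : {bseq N of 'I_4}, word x = b by exists (val
  (enum_val x)).1.
rewrite (bigD1 bx) //= [X in _ + X]big1 ?addr0; last first.
  move=> b nb; rewrite big1 // => l _.
  rewrite /v bxE (_ : (bx == b :> seq _) = false) ?mul0r ?conjC0 ?mul0r ?mulr0 //.
  by rewrite (inj_eq val_inj) eq_sym (negbTE nb).
rewrite /shifted; have [wxx|] := eqVneq (word x) (word x'); last first.
  move=> nw; rewrite big1 ?mul0r ?subrr //.
  move=> l _; rewrite /v -bxE [word x' == _]eq_sym (negbTE nw).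
  by rewrite !mul0r mulr0 mul0r mulr0.
have lx : (level x <= 2 * N)%N by have := level_le x; lia.
have lx' : (level x' <= 2 * N)%N by have := level_le x'; have := size_word x';
  lia.
transitivity (\sum_(l < (2 * N).+2) lam bx * om x x' *
  (s bx * (s bx)^* * (((level x).+1 == l)%:R * ((level x').+1 == l)%:R)
   + a bx * (a bx)^* * ((level x == l)%:R * (level x' == l)%:R)
   - a bx * (s bx)^* * ((level x' == l)%:R * ((level x).+1 == l)%:R)
   - (a bx)^* * s bx * ((level x == l)%:R * ((level x').+1 == l)%:R))).
  apply: eq_bigr => l _;
    rewrite /v -bxE -wxx eqxx !mul1r rmorphB !rmorphM !rmorph_nat.
  ring.
rewrite -mulr_sumr !sumrB big_split /= -!mulr_sumr !sum_level ?eqSS; try lia.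
rewrite addr0 -bxE.
have -> : ((level x')%:Z == (level x)%:Z) = (level x == level x') by rewrite
  eq_sym.
have -> : ((level x')%:Z == (level x)%:Z + 1) = (level x' == (level x).+1) by
  apply/eqP/eqP; lia.
have -> : ((level x')%:Z == (level x)%:Z + - 1) = (level x == (level x').+1) by
  apply/eqP/eqP; lia.
ring.
Qed.

End Positivity.

(** * Coherence of the emitted qubit *)

Section Output.
Variables (C : numClosedFieldType) (N : nat) (rho : 'M[C]_2).
Hypothesis rho_state : is_state rho.
Hypothesis rho01 : rho 0 1 != 0.
Local Notation d := (dimC N).
Local Notation wsum := (@wsum C).
Implicit Types (b : seq 'I_4).

Let g := rho 0 1 * rho 1 0.

Let c01 : (rho 0 1)^* = rho 1 0. Proof. exact/psdmx_conj/(proj1 rho_state). Qed.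
Let c10 : (rho 1 0)^* = rho 0 1. Proof. exact/psdmx_conj/(proj1 rho_state). Qed.

Lemma coherence_gt0 : 0 < g.
Proof. by rewrite /g -c01 -normCK exprn_gt0 // normr_gt0. Qed.

(* Since wsum b estimates (size b) rho_10 T, the emitted amplitudes have ratio
   close to T. *)
Definition phase_ref b : C := (size b)%:R * rho 1 0.
Definition emit_norm2 b : C := phase_ref b * (phase_ref b)^* + wsum b * (wsum
  b)^*.
Definition emit b (r : 'I_2) : C := (if r == 0 then phase_ref b else wsum b) /
  sqrtC (emit_norm2 b).

Let phase_ref_sq b : phase_ref b * (phase_ref b)^* = (size b)%:R ^+ 2 * g.
Proof. by rewrite /phase_ref rmorphM rmorph_nat /= c10 /g; ring. Qed.

Lemma emit_norm2_ge0 b : 0 <= emit_norm2 b.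
Proof. by rewrite addr_ge0 // mul_conjC_ge0. Qed.

Lemma emit_norm2_gt0 b : b != [::] -> 0 < emit_norm2 b.
Proof.
move=> nb; rewrite ltr_wpDr ?mul_conjC_ge0 // phase_ref_sq mulr_gt0
  ?coherence_gt0 //.
by rewrite exprn_gt0 // ltr0n lt0n size_eq0.
Qed.

Let conj_sqrt_norm2 b : (sqrtC (emit_norm2 b))^* = sqrtC (emit_norm2 b).
Proof. by apply/CrealP/ger0_real; rewrite sqrtC_ge0 emit_norm2_ge0. Qed.

Let emitM b (x y : C) : x / sqrtC (emit_norm2 b) * (y / sqrtC (emit_norm2 b))^*
  = x * y^* / emit_norm2 b.
Proof.
rewrite rmorphM fmorphV /= conj_sqrt_norm2 -[emit_norm2 b in RHS]sqrtCK expr2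
  invfM; ring.
Qed.

(** On the empty record [phase_ref] and [wsum] both vanish and [emit] is a division by zero. The
    channel evaluates amplitudes only at records just extended by a letter. *)
Lemma emit_unit b : b != [::] -> \sum_r emit b r * (emit b r)^* = 1.
Proof.
move=> /emit_norm2_gt0 nb; rewrite sum_ord2 /emit /= !emitM -mulrDl divff //.
exact: lt0r_neq0.
Qed.

(** With [a = phase_ref] and [s = wsum], positivity of a weighted |s - a T|^2 together with the
    moments gives [k^2 g (1 - o1 - o2) <= k - k g], where [o1] and [o2] are the two output
    coherences. *)
Lemma output_bound k : (0 < k <= N)%N ->
  1 - (corr 1 (fun b => emit b 0 * (emit b 1)^*) (stage N emit rho k) +
       corr (- 1) (fun b => emit b 1 * (emit b 0)^*) (stage N emit rho k)) <=
         (k%:R * g)^-1.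
Proof.
move=> /andP[k0 kN]; set om := stage _ _ _ _.
have dk : depth k om by exact: stage_depth.
(* This weight turns [lam (|a|^2 + |s|^2)] into |s|^2, and [lam a conj(s)] into [a conj(s)] minus
   |a|^2 times the emitted coherence. As |a|^2 is [k^2 g] on all records of length [k], only known
   moments and the output remain. *)
pose lam b := wsum b * (wsum b)^* / emit_norm2 b.
have lam0 b : 0 <= lam b by rewrite divr_ge0 ?emit_norm2_ge0 ?mul_conjC_ge0.
have := corr_quad_ge0 phase_ref wsum (@stage_psd C N emit rho rho_state k)
  lam0; rewrite -/om.
have nk b : size b = k -> emit_norm2 b != 0.
  by move=> bk; rewrite lt0r_neq0 // emit_norm2_gt0 // -size_eq0 bk -lt0n.
rewrite (@eq_corr _ _ k 0 _ (fun b => wsum b * (wsum b)^*) _ dk); last first.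
  by move=> b /nk nb; rewrite -/(emit_norm2 b) /lam mulfVK.
rewrite (@eq_corr _ _ k 1 _ (fun b => k%:R * rho 1 0 * (wsum b)^* +
    (- (k%:R ^+ 2 * g)) * (emit b 0 * (emit b 1)^*)) _ dk); last first.
  move=> b bk; rewrite /emit /= emitM -bk -phase_ref_sq /lam.
  have -> : wsum b * (wsum b)^* = emit_norm2 b - phase_ref b * (phase_ref b)^*
    by rewrite /emit_norm2 addrAC subrr add0r.
  rewrite -/(phase_ref b); have := nk _ bk; set n := emit_norm2 b => n0.
  by field.
rewrite (@eq_corr _ _ k (- 1) _ (fun b => k%:R * rho 0 1 * wsum b +
    (- (k%:R ^+ 2 * g)) * (emit b 1 * (emit b 0)^*)) _ dk); last first.
  move=> b bk; rewrite /emit /= emitM -bk -phase_ref_sq /lam.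
  have -> : wsum b * (wsum b)^* = emit_norm2 b - phase_ref b * (phase_ref b)^*
    by rewrite /emit_norm2 addrAC subrr add0r.
  have -> : (size b)%:R * rho 0 1 = (phase_ref b)^* by rewrite /phase_ref
    rmorphM rmorph_nat /= c10.
  have := nk _ bk; set n := emit_norm2 b => n0.
  by field.
rewrite !corrD !corrZ (corr0_wsum_sq emit_unit) // (corr1_wsum emit_unit) //
  (corrN1_wsum emit_unit) //.
rewrite -/om -/g; set o1 := corr 1 _ _; set o2 := corr (- 1) _ _ => h.
have k0' : 0 < k%:R :> C by rewrite ltr0n.
have kg : 0 < k%:R * g by rewrite mulr_gt0 // coherence_gt0.
rewrite -(ler_pM2l kg) divff ?lt0r_neq0 // -(ler_pM2l k0') mulr1.
rewrite -subr_ge0; apply: le_trans h _; rewrite -subr_ge0.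
(* The discarded slack is the positive term [k g]. *)
rewrite (_ : _ - _ = k%:R * g) ?ltW //.
by rewrite /g; ring.
Qed.

End Output.

(** * The invariant catalyst state and its output *)

Section Average.
Variables (C : numClosedFieldType) (N : nat) (rho : 'M[C]_2).
Hypothesis rho_state : is_state rho.
Hypothesis rho01 : rho 0 1 != 0.
Local Notation d := (dimC N).
Local Notation emit := (emit rho).
Local Notation stage := (stage N emit rho).
Local Notation channel := (@channel C N emit).

Definition catalyst : 'M[C]_d := N.+1%:R^-1 *: \sum_(k < N.+1) stage k.

Definition output : 'M[C]_2 := ptrace2 (channel (rho *t catalyst)).

Lemma catalyst_state : is_state catalyst.
Proof.
split; first by apply/psdmxZ/psdmx_sum => [|k _];
  [rewrite invr_ge0 ler0n | exact: stage_psd].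
rewrite mxtraceZ raddf_sum /= (eq_bigr (fun=> 1)) => [|k _].
  by rewrite sumr_const card_ord mulVf // pnatr_eq0.
by apply: stage_tr => //; exact: emit_unit.
Qed.

Lemma channel_catalyst : channel (rho *t catalyst) =
  N.+1%:R^-1 *: \sum_(k < N.+1) channel (rho *t stage k).
Proof.
rewrite /catalyst /channel -linear_sum -linearZ /=; congr (kraus _ _).
apply/matrixP => u v; rewrite !mxE !summxE mulrCA; congr (_ * _).
by rewrite mulr_sumr; apply: eq_bigr => k _; rewrite mxE.
Qed.

Lemma catalyst_fixed : ptrace1 (channel (rho *t catalyst)) = catalyst.
Proof.
transitivity (N.+1%:R^-1 *: \sum_(k < N.+1) stage k.+1).
  rewrite channel_catalyst; apply/matrixP => x x'; rewrite !mxE.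
  rewrite sum_ord2 !mxE !summxE -mulrDr -big_split; congr (_ * _).
  by apply: eq_bigr => k _; rewrite [RHS]mxE sum_ord2.
(* One step shifts the times by one, and the last term wraps around to the first by
   [stage_cycle]. *)
rewrite /catalyst big_ord_recr [in RHS]big_ord_recl addrC /=;
  congr (_ *: (_ + _)).
have := @stage_cycle C N emit (emit_unit rho_state rho01) rho rho_state;
  rewrite /stage iterS; exact.
Qed.

Lemma outputE ra rb : output ra rb =
  N.+1%:R^-1 * \sum_(k < N.+1) ptrace2 (channel (rho *t stage k)) ra rb.
Proof.
rewrite /output channel_catalyst mxE; under eq_bigr do rewrite mxE summxE.
rewrite -mulr_sumr exchange_big; congr (_ * _).
by apply: eq_bigr => k _; rewrite mxE.
Qed.

Lemma output_state : is_state output.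
Proof.
have [pc tc] := catalyst_state; have [pr tr] := rho_state; split.
  exact/psdmx_ptrace2/kraus_psd/psdmx_tens.
rewrite /output tr_ptrace2 /channel kraus_tp ?tr_tens ?tr ?tc ?mul1r //.
exact/kraus_op_tp/emit_unit.
Qed.

(** At time [k < N] the emission uses [k.+1] letters and obeys [output_bound]. At time [N] the reset
    emits an incoherent qubit, which costs the extra 1. *)
Lemma output_coherence : 1 - (output 0 1 + output 1 0) <=
  N.+1%:R^-1 * (\sum_(k < N) (k.+1%:R * (rho 0 1 * rho 1 0))^-1 + 1).
Proof.
have N0 : N.+1%:R != 0 :> C by rewrite pnatr_eq0.
rewrite !outputE -mulrDr -{1}(mulVf N0) -mulrBr ler_pM2l ?invr_gt0 ?ltr0n //.
have -> : N.+1%:R = \sum_(k < N.+1) 1 :> C by rewrite sumr_const card_ord.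
rewrite -big_split -sumrB big_ord_recr /= lerD //.
  apply: ler_sum => k _.
  have dk : depth k (stage k) by apply: stage_depth; exact: ltnW.
  rewrite !(ptrace2_step (emit_unit rho_state rho01) _ _ _ (ltn_ord k) dk).
  rewrite -[catalyst_map _ _ _]/(stage k.+1).
  exact: (@output_bound C N rho rho_state rho01 k.+1 (ltn_ord k)).
have off_diag (ra rb : 'I_2) : ra != rb -> ptrace2 (channel (rho *t stage N))
  ra rb = 0.
  move=> ne; rewrite channel_final //; last exact: stage_depth.
  rewrite mxE big1 // => x _; rewrite !mxE !(can_eq (@mxtens_indexK _ _)).
  have [ra0|ra0] := eqVneq ra 0;
    last by rewrite -pair_eqE /pair_eq /= (negbTE ra0) mulr0.
  have rb0 : (rb == 0) = false by apply/negbTE; rewrite eq_sym -ra0.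
  by rewrite -!pair_eqE /pair_eq /= rb0 !andbF mulr0.
by rewrite !off_diag // addr0 subr0.
Qed.

End Average.

(** * Energy conservation *)

Section Energies.
Local Open Scope complex_scope.
Variables (R : realType) (Delta : R) (N : nat).
Local Notation C := R[i].
Local Notation d := (dimC N).

(** Energy decreases along the ladder because qubit label 1 has the lower energy. With this sign the
    total energy depends only on label plus level. *)
Definition ladder_ham : 'M[C]_d := diag_mx (\row_x (- (level x)%:R * Delta)%:C).

(* The qubit label s has energy Delta / 2 - s Delta, and ladder level m has energy
   - m Delta. *)
Definition energy (u : 'I_(2 * d)) : R :=
  Delta / 2 - ((mxtens_unindex u).1 + level (mxtens_unindex u).2)%:R * Delta.

Lemma ladder_ham_hermsym : ladder_ham \is hermsymmx.
Proof.
apply/is_hermitianmxP; rewrite expr0 scale1r; apply/matrixP => x y; rewrite !mxE.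
have [->|nxy] := eqVneq x y; last by rewrite !mulr0n rmorph0.
by rewrite !mulr1n; apply/esym/CrealP/complex_realP; eexists.
Qed.

Lemma total_ham_ladder :
  total_ham (qubit_ham Delta) ladder_ham = diag_mx (\row_u (energy u)%:C).
Proof.
apply/matrixP => u v; case: (mxtens_indexP u) => s x;
  case: (mxtens_indexP v) => s' x'.
rewrite mxE !tensmxE !mxE (can_eq (@mxtens_indexK _ _)) /energy mxtens_indexK
  -pair_eqE /pair_eq /=.
have [_|_] := eqVneq s s'; last by rewrite !mulr0n !mulr0 !mul0r addr0.
have [_|_] := eqVneq x x'; last by rewrite !mulr0n !mulr0 addr0.
rewrite !mulr1n mulr1 mul1r.
have -> : (-1) ^+ s = ((-1) ^+ s)%:C :> C by rewrite rmorphXn rmorphN1.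
rewrite -rmorphM -rmorphD /=; congr (_%:C); rewrite natrD.
by case: s => [[|[|//]] hs] /=; rewrite ?expr0 ?expr1; field.
Qed.

Lemma step_entry_level (c : seq 'I_4 -> 'I_2 -> C) (r s : 'I_2) (y x : 'I_d) :
  step_entry c r y s x != 0 -> (r + level y)%N = (s + level x).+1.
Proof.
rewrite /step_entry; case gx: (growing x); last by rewrite mul0r eqxx.
apply: contraNeq => ny; rewrite big1 ?mulr0 // => j _.
case: eqP => [yE|_]; last by rewrite mulr0.
have h2 : (s + (1 - r) <= 2)%N by case: s {yE ny} => [[|[|//]] hs] /=;
  case: r => [[|[|//]] hr].
move: ny; rewrite yE (proj2 (childP j gx h2)) => /eqP[].
by case: (r) => [[|[|//]] hr] /=; lia.
Qed.

(** The step raises label plus level by exactly one. Each reset operator has at most one nonzero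
    entry, so its energy shift is unambiguous; this is why nodes are reset one at a time. *)
Lemma kraus_op_homogeneous (c : seq 'I_4 -> 'I_2 -> C) (a : unit + 'I_(2 * d)) :
  exists w, forall u v, kraus_op c a u v != 0 -> energy u = energy v + w.
Proof.
case: a => [[]|v0] /=.
  exists (- Delta) => u v; rewrite mxE => /step_entry_level;
    rewrite /energy => ->.
  by rewrite -natr1; ring.
exists (energy (mxtens_index (0, origin N)) - energy v0) => u v; case: ifP => _.
  by rewrite mxE eqxx.
rewrite mxE; case: andP => [[/eqP-> /eqP->] _|_]; last by rewrite eqxx.
by rewrite addrC subrK.
Qed.

End Energies.

(** * Choice of the number of steps *)

Section Averaging.
Local Open Scope classical_set_scope.

Lemma harmonic_average_small (R : realType) (a e : R) : 0 < e ->
  exists N, N.+1%:R^-1 * (\sum_(k < N) (k.+1%:R * a)^-1 + 1) <= e.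
Proof.
move=> e0.
have h1 := @cvg_harmonic R.
have h2 := cesaro h1.
(* The Cesaro mean has [N.+1] terms, one more than the sum. The second null sequence pays for the
   constant 1 and dominates the extra term whatever the sign of [a]. *)
have : (fun N => a^-1 * arithmetic_mean (@harmonic R) N + (1 + `|a^-1|) *
  harmonic N) @ \oo --> (a^-1 * 0 + (1 + `|a^-1|) * 0 : R).
  by apply: cvgD; apply: cvgM => //; exact: cvg_cst.
rewrite !mulr0 addr0 => /cvgrPdist_le/(_ e e0)[N _ /(_ N (leqnn N))].
rewrite sub0r normrN => hN; exists N; apply: le_trans (le_trans (ler_norm _) hN).
rewrite /arithmetic_mean /series /= big_mkord big_ord_recr /=.
under eq_bigr do rewrite invfM.
rewrite -mulr_suml /harmonic /=.
set S := \sum_(k < N) _; set n := N.+1%:R^-1.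
have n0 : 0 <= n by rewrite invr_ge0 ler0n.
have n1 : n <= 1 by rewrite invf_le1 ?ltr0n // ler1n.
have -> : a^-1 * (n * (S + n)) + (1 + `|a^-1|) * n = n * (S * a^-1 + 1) + n *
  (a^-1 * n + `|a^-1|) by ring.
rewrite lerDl mulr_ge0 //.
have : - (`|a^-1| * n) <= a^-1 * n by rewrite -mulNr ler_wpM2r // lerNl -normrN
  ler_norm.
have : `|a^-1| * n <= `|a^-1| by rewrite ler_piMr.
by lra.
Qed.

End Averaging.

Local Open Scope complex_scope.

(** If the entry vanishes, so does its conjugate; then [rho] is diagonal and commutes with the
    diagonal Hamiltonian. *)
Lemma coherent_entry_neq0 (R : realType) (Delta : R) (rho : 'M[R[i]]_2) :
  is_state rho -> rho *m qubit_ham Delta - qubit_ham Delta *m rho <> 0 -> rho 0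
    1 != 0.
Proof.
move=> srho hcoh; apply: contra_notN hcoh => /eqP r01.
have r10 : rho 1 0 = 0 by rewrite -(psdmx_conj 0 1 (proj1 srho)) r01 conjC0.
by apply: mx2P; rewrite !mxE !sum_ord2 !mxE /= ?r01 ?r10; ring.
Qed.

Theorem mainTheorem3 (R : realType) (Delta : R) (hDelta : 0 < Delta)
    (rho : 'M[R[i]]_2) (hrho : is_state rho)
    (hcoh : rho *m qubit_ham Delta - qubit_ham Delta *m rho <> 0)
    (eps : R) (heps : 0 < eps) :
  exists rho' : 'M[R[i]]_2,
    [/\ is_state rho',
        trace_norm (rho' - rho_plus R[i]) <= eps%:C
      & CCTIO_transformable (qubit_ham Delta) rho rho'].
Proof.
have r01 := coherent_entry_neq0 hrho hcoh.
have g0 := coherence_gt0 hrho r01.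
have [gr gE] : exists gr : R, rho 0 1 * rho 1 0 = gr%:C.
  by apply/complex_realP/ger0_real/ltW.
(* The tolerance [eps ^+ 2 / 2] is the coherence defect that [trace_norm_sub_rho_plus] converts into
   trace distance [eps]. *)
have [|N hN] := @harmonic_average_small R gr (eps ^+ 2 / 2).
  by rewrite divr_gt0 // exprn_gt0.
exists (output N rho); split.
- exact: output_state.
- apply: trace_norm_sub_rho_plus; first exact: output_state.
    by rewrite ler0c ltW.
  apply: le_trans (output_coherence N hrho r01) _; rewrite gE.
  have -> : eps%:C ^+ 2 / 2 = (eps ^+ 2 / 2)%:C.
    by rewrite rmorphM rmorphXn fmorphV rmorph_nat.
  move: hN; rewrite -lecR; apply: le_trans.
  rewrite rmorphM fmorphV rmorph_nat rmorphD rmorph1 rmorph_sum /=.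
  rewrite (eq_bigr (fun k : 'I_N => ((k.+1%:R * gr)^-1)%:C)) // => k _.
  by rewrite fmorphV rmorphM rmorph_nat.
exists (dimC N), (ladder_ham Delta N), (catalyst N rho), (kraus (@kraus_op _ N
  (emit rho))).
split => //.
- exact: ladder_ham_hermsym.
- exact: catalyst_state.
- rewrite total_ham_ladder; apply: kraus_TIO.
    exact: kraus_op_homogeneous.
  exact/kraus_op_tp/emit_unit.
- exact: catalyst_fixed.
Qed.
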